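(* Let $p,q\in[1,\infty)$. For $a\in[0,1)$ put $$A_{p,q}(a)=\frac{(1-a^p)^{1/q}}{1-a^2+a(1-a^p)^{1/q}},\qquad S_{p,q}(a)=\left(\frac{(1-a^p)^{2/q}}{1-a^2+(1-a^p)^{2/q}}\right)^{1/2},$$ and let $\widehat a$ be the unique root in $(0,1)$ of $x^p+x^q=1$. Then: (i) if $p,q\in[1,2]$, $R_{p,q}(\mathbb C)=\inf_{a\in[\widehat a,1)}A_{p,q}(a)$; (ii) if $p\in(2,\infty)$ and $q\in[1,2]$, $R_{p,q}(\mathbb C)=\min\{1/\sqrt2,\ \inf_{a\in[\widehat a,1)}A_{p,q}(a)\}$; (iii) if $p,q\in[2,\infty)$, $R_{p,q}(\mathbb C)=1/\sqrt2$; (iv) if $q\in(2,\infty)$, then $R_{2,q}(\mathbb C)=1/\sqrt2$; and if $p\in[1,2)$, $q\in(2,\infty)$ and moreover $q\widehat a^{2}+p\widehat a^{p+2}\le p\widehat a^{p}+q\widehat a^{p+2}$, then $R_{p,q}(\mathbb C)=\inf_{a\in[\widehat a,1)}A_{p,q}(a)$; (v) in general, for $p\in[1,2)$ and $q\in(2,\infty)$, $$0<\inf_{a\in[0,1)}S_{p,q}(a)\le R_{p,q}(\mathbb C)\le \frac1{\sqrt2}.$$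
   Context: $\mathbb D$ is the open unit disk. For a complex Banach space $X$ and $p,q\in[1,\infty)$, and a holomorphic $f:\mathbb D\to X$, $f(z)=\sum_{k\ge0}x_kz^k$, with $\sup_{z\in\mathbb D}\|f(z)\|\le1$, let $R_{p,q}(f,X)=\sup\{r\ge0:\ \|x_0\|^p+(\sum_{k\ge1}\|x_k\|\,|z|^k)^q\le1 \text{ for all } |z|<r\}$, and $R_{p,q}(X)=\inf\{R_{p,q}(f,X): f:\mathbb D\to X \text{ holomorphic}, \sup_{\mathbb D}\|f\|\le1\}$. Here $X=\mathbb C$ with the modulus. *)

(* Defs.v *)
From Stdlib Require Import Reals.
From Coquelicot Require Import Coquelicot.
Open Scope R_scope.

(* Real power x^y for x >= 0, y > 0, with the convention 0^y = 0
   (Stdlib's Rpower 0 y = 1, which is the wrong convention). *)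
Definition rpow (x y : R) : R :=
  if Req_EM_T x 0 then 0 else Rpower x y.

(* A holomorphic function f : D -> C, f(z) = sum_k x_k z^k, is represented by
   its Taylor coefficient sequence x : nat -> C, the power series converging
   on the whole open unit disk. *)
Definition admissible (x : nat -> Complex.C) : Prop :=
  forall z : Complex.C, Cmod z < 1 ->
    exists w : Complex.C,
      @is_series C_AbsRing C_NormedModule (fun k => mult (x k) (pow_n z k)) w /\
      Cmod w <= 1.

Definition bohr_ineq (p q : R) (x : nat -> Complex.C) (r : R) : Prop :=
  forall z : Complex.C, Cmod z < r ->
    exists s : R,
      is_series (fun k => Cmod (x (S k)) * Cmod z ^ (S k)) s /\
      rpow (Cmod (x O)) p + rpow s q <= 1.

Definition R_f (p q : R) (x : nat -> Complex.C) : Rbar :=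
  Rbar_lub (fun r : Rbar => exists r0 : R, r = Finite r0 /\ 0 <= r0 /\ bohr_ineq p q x r0).

Definition R_C (p q : R) : Rbar :=
  Rbar_glb (fun v : Rbar => exists x : nat -> Complex.C, admissible x /\ v = R_f p q x).

Definition A_pq (p q a : R) : R :=
  rpow (1 - rpow a p) (1 / q) / (1 - a ^ 2 + a * rpow (1 - rpow a p) (1 / q)).

Definition S_pq (p q a : R) : R :=
  sqrt (rpow (1 - rpow a p) (2 / q) / (1 - a ^ 2 + rpow (1 - rpow a p) (2 / q))).

Definition inf_on (lo : R) (F : R -> R) : Rbar :=
  Glb_Rbar (fun y : R => exists a : R, lo <= a < 1 /\ y = F a).

(* Main.v *)
Require Import Defs.
From Stdlib Require Import Reals Lra Lia.
From Coquelicot Require Import Coquelicot.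
Open Scope R_scope.

(* Let [f = sum x_k z^k] be bounded by 1 and [a = |x_0|].  Parseval on circles of radius
   [r -> 1], applied to [f(z) (1 + c z^n)], gives
   [|x_n|^2 <= (1 - a^2) (1 - sum_(k<n) |x_k|^2)].  Summing these with weights [rho^k] yields
   [sum_(k>=1) |x_k|^2 rho^k <= rho (1 - a^2)^2 / (1 - a^2 rho)], and Cauchy-Schwarz bounds the
   majorant series by [(1 - a^2) r / sqrt ((1 - a^2 rho) (1 - r^2 / rho))] for every
   [r^2 < rho <= 1].  With [rho = r / a] this shows that [r <= A_pq a] suffices when
   [a >= ahat], and with [rho = 1] that [r <= S_pq a] always suffices.  The Moebius maps
   [(a - z) / (1 - a z)], and [z] times the one with [a = 1 / sqrt 2], give the upper bounds.
   It remains to compare [S_pq] on [[0, ahat)] with [S_pq ahat = A_pq ahat = ahat] and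
   [S_pq 0 = 1 / sqrt 2], which amounts to the monotonicity of [(1 - a^2)^q / (1 - a^p)^2]. *)

(** The product [(1 - a^2 rho) (1 - r^2 / rho)] is largest at [rho = r / a], where both factors
    equal [1 - a r]. The bound is then [(1 - a^2) r / (1 - a r)], which is exactly the majorant of
    the Moebius map, so nothing is lost. The constraint [rho <= 1] permits this only for [r <= a],
    and [A_pq a <= a] holds exactly when [ahat <= a]; for smaller [a] only [rho = 1] remains, and
    this is how [S_pq] enters. The case distinction in [p] and [q] reflects the sign of the
    derivative of the logarithm of [(1 - a^2)^q / (1 - a^p)^2]. It is nonnegative for [p, q <= 2].
    For [q <= 2 < p] it can change only from negative to positive, so the worst [a] below [ahat]
    sits at an end of the interval and the minimum with [1 / sqrt 2] appears. For [p < 2 < q] it can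
    change only from positive to negative, so a sign condition at [ahat] settles the whole interval.
    Parseval is used in finite form, as an average of truncated series over roots of unity, so no
    integral occurs. *)

Definition psum (y : nat -> C) (z w : C) : Prop :=
  @is_series C_AbsRing C_NormedModule (fun k => (y k * z ^ k)%C) w.

Lemma pow_n_Cpow (z : C) (n : nat) : @pow_n C_Ring z n = (z ^ n)%C.
Proof.
  induction n as [|n IH]; [reflexivity|].
  simpl. now rewrite IH.
Qed.

Lemma admissible_psum (x : nat -> C) :
  admissible x <->
  (forall z, Cmod z < 1 -> exists w, psum x z w /\ Cmod w <= 1).
Proof.
  split; intros H z Hz; destruct (H z Hz) as [w [Hw Hb]]; exists w; split; auto;
    revert Hw; apply is_series_ext; intros k;
    change (@mult C_AbsRing (x k) (pow_n z k)) with (x k * @pow_n C_Ring z k)%C;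
    now rewrite pow_n_Cpow.
Qed.

(** * Convergence of power series on circles *)

Lemma is_series_Cmod_eps (a : nat -> C) (l : C) (eps : R) :
  @is_series C_AbsRing C_NormedModule a l -> 0 < eps ->
  exists N, forall n, (N <= n)%nat ->
    Cmod (@sum_n C_AbelianMonoid a n - l)%C < eps.
Proof.
  intros H He.
  unfold is_series in H.
  (* Balls of [C] are squares for the product structure; half-side [eps / sqrt 2] keeps the square
     inside the disk of radius [eps]. *)
  assert (He2 : 0 < eps / sqrt 2).
  { apply Rdiv_lt_0_compat; [auto|]. apply sqrt_lt_R0; lra. }
  destruct (proj1 (filterlim_locally _ _) H (mkposreal _ He2)) as [N HN].
  exists N; intros n Hn.
  specialize (HN n Hn).
  apply (C_NormedModule_mixin_compat2 l _ (mkposreal _ He2)) in HN.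
  simpl in HN.
  replace (sqrt 2 * (eps / sqrt 2)) with eps in HN
    by (field; apply Rgt_not_eq, sqrt_lt_R0; lra).
  exact HN.
Qed.

Lemma psum_coef_bound (y : nat -> C) (z w : C) :
  psum y z w -> exists K, forall k, Cmod (y k) * Cmod z ^ k <= K.
Proof.
  intros H.
  destruct (is_series_Cmod_eps _ _ 1 H Rlt_0_1) as [N HN].
  assert (HF : forall n, exists K, forall k, (k <= n)%nat -> Cmod (y k) * Cmod z ^ k <= K).
  { induction n as [|n [K IH]].
    - exists (Cmod (y O) * Cmod z ^ 0). intros k Hk.
      replace k with O by lia. lra.
    - exists (Rmax K (Cmod (y (S n)) * Cmod z ^ S n)). intros k Hk.
      destruct (Nat.eq_dec k (S n)) as [->|Hne].
      + apply Rmax_r.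
      + eapply Rle_trans; [apply IH; lia | apply Rmax_l]. }
  destruct (HF N) as [K HK].
  (* Beyond [N] a term is the difference of two consecutive partial sums, each within 1 of [w]. *)
  exists (Rmax K 2). intros k.
  destruct (Nat.le_gt_cases k N) as [Hk|Hk].
  - eapply Rle_trans; [apply HK; auto | apply Rmax_l].
  - eapply Rle_trans; [|apply Rmax_r].
    destruct k as [|k]; [lia|].
    rewrite <- Cmod_pow, <- Cmod_mult.
    pose proof (HN (S k) ltac:(lia)) as H1.
    pose proof (HN k ltac:(lia)) as H2.
    rewrite sum_Sn in H1.
    set (s := @sum_n C_AbelianMonoid (fun k => (y k * z ^ k)%C) k) in *.
    change (plus s (y (S k) * z ^ S k)%C) with (s + y (S k) * z ^ S k)%C in H1.
    replace (y (S k) * z ^ S k)%C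
      with ((s + y (S k) * z ^ S k - w) + - (s - w))%C by ring.
    eapply Rle_trans; [apply Cmod_triangle|].
    rewrite Cmod_opp. lra.
Qed.

Lemma psum_abs_series (y : nat -> C) (r : R) :
  (forall z, Cmod z < 1 -> exists w, psum y z w) -> 0 < r < 1 ->
  ex_series (fun k => Cmod (y k) * r ^ k).
Proof.
  intros Hy Hr.
  (* The terms are bounded at the intermediate radius [r'], so at [r] they decay at least like
     [(r / r')^k]. *)
  set (r' := (1 + r) / 2).
  assert (Hr' : r < r' < 1) by (unfold r'; lra).
  destruct (Hy (RtoC r')) as [w Hw].
  { rewrite Cmod_R, Rabs_pos_eq; lra. }
  destruct (psum_coef_bound _ _ _ Hw) as [K HK].
  rewrite Cmod_R, Rabs_pos_eq in HK by lra.
  apply @ex_series_le with (b := fun k => K * (r / r') ^ k).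
  - intros k. change (norm ?x) with (Rabs x).
    rewrite Rabs_pos_eq
      by (apply Rmult_le_pos; [apply Cmod_ge_0 | apply pow_le; lra]).
    replace (r ^ k) with (r' ^ k * (r / r') ^ k).
    2:{ rewrite <- Rpow_mult_distr. f_equal. field. lra. }
    rewrite <- Rmult_assoc. apply Rmult_le_compat_r; [|apply HK].
    apply pow_le, Rdiv_le_0_compat; lra.
  - apply @ex_series_scal_l. exists (/ (1 - r / r')). apply is_series_geom.
    rewrite Rabs_pos_eq by (apply Rdiv_le_0_compat; lra).
    apply (Rmult_lt_reg_r r'); [lra|]. unfold Rdiv.
    rewrite Rmult_assoc, Rinv_l; lra.
Qed.

(** The tail is dominated by that of [sum |y_k| r^k], so [M0] serves the whole circle. This
    uniformity matters because the sample points used later, roots of unity of order [M + 1], vary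
    with the truncation degree [M]. *)
Lemma psum_uniform (y : nat -> C) (r eps : R) :
  (forall z, Cmod z < 1 -> exists w, psum y z w) -> 0 < r < 1 -> 0 < eps ->
  exists M0, forall M z w, (M0 <= M)%nat -> Cmod z = r -> psum y z w ->
    Cmod (@sum_n C_AbelianMonoid (fun k => (y k * z ^ k)%C) M) <= Cmod w + eps.
Proof.
  intros Hy Hr He.
  assert (He2 : 0 < eps / 2) by lra.
  destruct (Cauchy_ex_series _ (psum_abs_series y r Hy Hr) (mkposreal _ He2))
    as [M0 HM]; simpl in HM.
  exists M0. intros M z w HM0 Hz Hw.
  destruct (is_series_Cmod_eps _ _ (eps / 2) Hw He2) as [N HN].
  set (m := S (M + N)).
  specialize (HN m ltac:(lia)).
  specialize (HM (S M) m ltac:(lia) ltac:(lia)).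
  assert (Hd : Cmod (@sum_n C_AbelianMonoid (fun k => (y k * z ^ k)%C) m -
                     @sum_n C_AbelianMonoid (fun k => (y k * z ^ k)%C) M)%C <= eps / 2).
  { pose proof (@sum_n_m_sum_n C_AbelianGroup (fun k => (y k * z ^ k)%C) M m ltac:(lia)) as E.
    change (minus ?a ?b) with (a - b)%C in E.
    apply Rle_trans with (Cmod (@sum_n_m C_AbelianMonoid (fun k => (y k * z ^ k)%C) (S M) m)).
    - right. f_equal. symmetry. exact E.
    - eapply Rle_trans.
      + apply (@norm_sum_n_m C_AbsRing C_NormedModule).
      + left. eapply Rle_lt_trans; [|exact HM].
        eapply Rle_trans; [|apply Rle_abs]. right.
        apply sum_n_m_ext. intros k. change (norm ?x) with (Cmod x).
        now rewrite Cmod_mult, Cmod_pow, Hz. }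
  set (s := @sum_n C_AbelianMonoid (fun k => (y k * z ^ k)%C) M) in *.
  set (t := @sum_n C_AbelianMonoid (fun k => (y k * z ^ k)%C) m) in *.
  replace s with (w + ((t - w) + - (t - s)))%C by ring.
  eapply Rle_trans; [apply Cmod_triangle|].
  apply Rplus_le_compat_l.
  eapply Rle_trans; [apply Cmod_triangle|]. rewrite Cmod_opp. lra.
Qed.

(** * Roots of unity and the discrete Parseval identity *)

Notation csum := (@sum_n C_AbelianMonoid).

(* [ring] and [field] do not see through the carriers of Coquelicot's structures. *)
Ltac Cring := match goal with |- @eq _ ?a ?b => change (@eq C a b); ring end.
Ltac Cfield := match goal with |- @eq _ ?a ?b => change (@eq C a b); field end.
Ltac Rring := match goal with |- @eq _ ?a ?b => change (@eq R a b); ring end.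

Definition root_of_unity (N : nat) : C := (cos (2 * PI / INR N), sin (2 * PI / INR N)).

Lemma cos_sin_pow (t : R) (n : nat) :
  ((cos t, sin t) ^ n)%C = (cos (INR n * t), sin (INR n * t)).
Proof.
  induction n as [|n IH].
  - simpl. rewrite Rmult_0_l, cos_0, sin_0. reflexivity.
  - rewrite Cpow_S, IH, S_INR, Rmult_plus_distr_r, Rmult_1_l, cos_plus, sin_plus.
    unfold Cmult; simpl. f_equal; ring.
Qed.

Lemma Cmod_cos_sin (t : R) : Cmod (cos t, sin t) = 1.
Proof.
  unfold Cmod; simpl.
  replace (_ + _) with 1; [apply sqrt_1|].
  pose proof (sin2_cos2 t) as H. unfold Rsqr in H. lra.
Qed.

Lemma root_of_unity_pow_N (N : nat) : (0 < N)%nat -> (root_of_unity N ^ N)%C = RtoC 1.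
Proof.
  intros HN. unfold root_of_unity. rewrite cos_sin_pow.
  replace (INR N * (2 * PI / INR N)) with (2 * PI)
    by (field; apply not_0_INR; lia).
  now rewrite cos_2PI, sin_2PI.
Qed.

(** The real part is [cos (2 u) = 1 - 2 sin^2 u] with [u = k PI / N] in [(0, PI)], where the sine is
    positive. *)
Lemma root_of_unity_pow_neq_1 (N k : nat) :
  (0 < k < N)%nat -> (root_of_unity N ^ k)%C <> RtoC 1.
Proof.
  intros Hk. unfold root_of_unity. rewrite cos_sin_pow. intros E.
  apply (f_equal fst) in E; simpl in E.
  set (u := INR k * PI / INR N).
  replace (INR k * (2 * PI / INR N)) with (2 * u) in E
    by (unfold u; field; apply not_0_INR; lia).
  rewrite cos_2a_sin in E.
  assert (0 < INR k) by (apply lt_0_INR; lia).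
  assert (INR k < INR N) by (apply lt_INR; lia).
  pose proof PI_RGT_0.
  assert (Hu : 0 < sin u).
  { apply sin_gt_0; unfold u.
    - apply Rdiv_lt_0_compat; nra.
    - apply (Rmult_lt_reg_r (INR N)); [lra|]. unfold Rdiv.
      rewrite Rmult_assoc, Rinv_l; nra. }
  nra.
Qed.

Lemma csum_geom (u : C) (n : nat) :
  ((u - 1) * csum (fun j => u ^ j)%C n = u ^ S n - 1)%C.
Proof.
  induction n as [|n IH].
  - rewrite sum_O. simpl. ring.
  - rewrite sum_Sn. change (plus ?a ?b) with (a + b)%C.
    rewrite Cmult_plus_distr_l, IH. rewrite (Cpow_S u (S n)). ring.
Qed.

Lemma csum_mult_r (a : C) (u : nat -> C) (n : nat) :
  csum (fun j => (u j * a)%C) n = (csum u n * a)%C.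
Proof. exact (@sum_n_mult_r C_Ring a u n). Qed.

Lemma csum_mult_l (a : C) (u : nat -> C) (n : nat) :
  csum (fun j => (a * u j)%C) n = (a * csum u n)%C.
Proof. exact (@sum_n_mult_l C_Ring a u n). Qed.

Lemma csum_plus (u v : nat -> C) (n : nat) :
  csum (fun j => (u j + v j)%C) n = (csum u n + csum v n)%C.
Proof. exact (@sum_n_plus C_AbelianMonoid u v n). Qed.

Lemma csum_conj (u : nat -> C) (n : nat) :
  csum (fun j => Cconj (u j)) n = Cconj (csum u n).
Proof.
  induction n as [|n IH].
  - now rewrite !sum_O.
  - rewrite !sum_Sn, IH. change (plus ?a ?b) with (a + b)%C.
    now rewrite Cplus_conj.
Qed.

Lemma Cconj_0 : Cconj 0 = 0.
Proof. apply injective_projections; simpl; ring. Qed.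

Lemma RtoC_sum_n (u : nat -> R) (n : nat) :
  RtoC (sum_n u n) = csum (fun j => RtoC (u j)) n.
Proof.
  induction n as [|n IH].
  - now rewrite !sum_O.
  - rewrite !sum_Sn, <- IH. apply RtoC_plus.
Qed.

Lemma Cpow_swap (w : C) (j k : nat) : ((w ^ j) ^ k = (w ^ k) ^ j)%C.
Proof. now rewrite <- !Cpow_mult_r, Nat.mul_comm. Qed.

(** Since [w] has modulus 1, the summand is [u ^ j] with [u] the conjugate of [w ^ (n - k)]. The
    geometric sum vanishes because [u ^ (N' + 1) = 1] while [u <> 1]. *)
Lemma roots_orthogonal (N' k n : nat) :
  (k < n <= N')%nat ->
  let w := root_of_unity (S N') in
  csum (fun j => ((w ^ j) ^ k * Cconj ((w ^ j) ^ n))%C) N' = RtoC 0.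
Proof.
  intros Hk w.
  assert (Hw : forall m, ((w ^ m) * Cconj (w ^ m) = 1)%C).
  { intros m. rewrite <- Cmod2_conj, Cmod_pow. unfold w, root_of_unity.
    now rewrite Cmod_cos_sin, !pow1. }
  set (u := Cconj (w ^ (n - k))%C).
  rewrite (sum_n_ext _ (fun j => (u ^ j)%C)).
  2:{ intros j. rewrite (Cpow_swap w j k), (Cpow_swap w j n).
      replace (w ^ n)%C with (w ^ k * w ^ (n - k))%C
        by (rewrite <- Cpow_add_r; f_equal; lia).
      rewrite Cpow_mult_l, Cmult_conj, Cmult_assoc.
      rewrite <- (Cpow_mult_r w k j), Hw, Cmult_1_l.
      unfold u. now rewrite Cpow_conj. }
  assert (HuN : (u ^ S N')%C = RtoC 1).
  { unfold u. rewrite <- Cpow_conj, Cpow_swap. unfold w.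
    rewrite root_of_unity_pow_N by lia. rewrite Cpow_1_l.
    apply injective_projections; simpl; ring. }
  assert (Hu1 : (u - 1)%C <> RtoC 0).
  { intros E. apply (root_of_unity_pow_neq_1 (S N') (n - k)); [lia|].
    fold w. rewrite <- (Cconj_conj (w ^ (n - k))%C). fold u.
    replace u with ((u - 1) + 1)%C by ring. rewrite E.
    apply injective_projections; simpl; ring. }
  assert (G : ((u - 1) * csum (fun j => u ^ j) N' = 0)%C)
    by (rewrite csum_geom, HuN; ring).
  destruct (Ceq_dec (csum (fun j => u ^ j)%C N') (RtoC 0)) as [H|H]; [exact H|].
  exfalso. now apply (Cmult_neq_0 _ _ Hu1 H).
Qed.

Lemma csum_poly_orthogonal (y : nat -> C) (N' M n : nat) :
  (M < n <= N')%nat ->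
  let w := root_of_unity (S N') in
  csum (fun j => (csum (fun k => y k * (w ^ j) ^ k)%C M * Cconj ((w ^ j) ^ n))%C) N' = RtoC 0.
Proof.
  intros HM w.
  assert (H1 : forall k, (k < n)%nat ->
    csum (fun j => (y k * (w ^ j) ^ k * Cconj ((w ^ j) ^ n))%C) N' = RtoC 0).
  { intros k Hk.
    rewrite (sum_n_ext _ (fun j => (y k * ((w ^ j) ^ k * Cconj ((w ^ j) ^ n)))%C))
      by (intros; now rewrite Cmult_assoc).
    rewrite csum_mult_l. unfold w. rewrite roots_orthogonal by lia. Cring. }
  induction M as [|M IH].
  - rewrite <- (H1 O ltac:(lia)). apply sum_n_ext. intros j. now rewrite sum_O.
  - rewrite (sum_n_ext _ (fun j =>
      (csum (fun k => y k * (w ^ j) ^ k)%C M * Cconj ((w ^ j) ^ n) +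
       y (S M) * (w ^ j) ^ S M * Cconj ((w ^ j) ^ n))%C)).
    + rewrite csum_plus, IH by lia. rewrite (H1 (S M) ltac:(lia)). Cring.
    + intros j. rewrite sum_Sn. change (plus ?a ?b) with (a + b)%C. Cring.
Qed.

(** With more than [M] sample points distinct monomials of degree at most [M] stay orthogonal. The
    induction splits off the top monomial [t] from [Q]; one cross term vanishes by orthogonality and
    the other is its conjugate. *)
Lemma discrete_parseval_C (y : nat -> C) (N' M : nat) :
  (M <= N')%nat ->
  let w := root_of_unity (S N') in
  let P := fun j => csum (fun k => y k * (w ^ j) ^ k)%C M in
  csum (fun j => (P j * Cconj (P j))%C) N' =
  (RtoC (INR (S N')) * csum (fun k => (y k * Cconj (y k))%C) M)%C.
Proof.
  intros HM w.
  assert (Hw : forall j k, ((w ^ j) ^ k * Cconj ((w ^ j) ^ k) = 1)%C).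
  { intros j k. rewrite <- Cmod2_conj, !Cmod_pow. unfold w, root_of_unity.
    now rewrite Cmod_cos_sin, !pow1. }
  assert (Hd : forall k,
    csum (fun j => ((y k * (w ^ j) ^ k) * Cconj (y k * (w ^ j) ^ k))%C) N' =
    (RtoC (INR (S N')) * (y k * Cconj (y k)))%C).
  { intros k.
    rewrite (sum_n_ext _ (fun j => RtoC (Cmod (y k) ^ 2))).
    - rewrite <- RtoC_sum_n, sum_n_const, RtoC_mult.
      f_equal. apply Cmod2_conj.
    - intros j. rewrite Cmod2_conj, Cmult_conj.
      transitivity ((y k * Cconj (y k)) * ((w ^ j) ^ k * Cconj ((w ^ j) ^ k)))%C;
        [Cring | rewrite Hw; Cring]. }
  induction M as [|M IH]; intros P.
  - rewrite sum_O, <- (Hd O). apply sum_n_ext. intros j. unfold P. now rewrite sum_O.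
  - set (Q := fun j => csum (fun k => y k * (w ^ j) ^ k)%C M).
    set (t := fun j => (y (S M) * (w ^ j) ^ S M)%C).
    assert (HQ : csum (fun j => (Q j * Cconj (t j))%C) N' = RtoC 0).
    { rewrite (sum_n_ext _ (fun j => ((Q j * Cconj ((w ^ j) ^ S M)) * Cconj (y (S M)))%C)).
      - rewrite csum_mult_r. unfold Q, w. rewrite csum_poly_orthogonal by lia. Cring.
      - intros j. unfold t. rewrite Cmult_conj. Cring. }
    rewrite (sum_n_ext _ (fun j => ((Q j * Cconj (Q j) + t j * Cconj (t j)) +
       (Q j * Cconj (t j) + Cconj (Q j * Cconj (t j))))%C)).
    + rewrite !csum_plus, csum_conj, HQ. unfold Q at 1 2, t. rewrite IH by lia.
      rewrite Hd, sum_Sn. change (plus ?a ?b) with (a + b)%C.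
      rewrite Cconj_0.
      Cring.
    + intros j. unfold P. rewrite sum_Sn. fold (Q j) (t j).
      change (plus ?a ?b) with (a + b)%C.
      rewrite Cplus_conj, Cmult_conj, Cconj_conj. Cring.
Qed.

Lemma discrete_parseval (y : nat -> C) (N' M : nat) :
  (M <= N')%nat ->
  let w := root_of_unity (S N') in
  sum_n (fun j => Cmod (csum (fun k => y k * (w ^ j) ^ k)%C M) ^ 2) N' =
  INR (S N') * sum_n (fun k => Cmod (y k) ^ 2) M.
Proof.
  intros HM w. apply RtoC_inj.
  rewrite RtoC_mult, !RtoC_sum_n.
  rewrite (sum_n_ext _ _ N' (fun j => Cmod2_conj _)).
  rewrite (sum_n_ext _ _ M (fun j => Cmod2_conj _)).
  now apply discrete_parseval_C.
Qed.

(** * Algebra of power series, in particular multiplication by [z] *)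

Lemma psum_plus (x y : nat -> C) (z u v : C) :
  psum x z u -> psum y z v -> psum (fun k => x k + y k)%C z (u + v)%C.
Proof.
  intros Hx Hy. unfold psum.
  apply (is_series_ext (fun k => plus (x k * z ^ k)%C (y k * z ^ k)%C)).
  - intros k. change (plus ?a ?b) with (a + b)%C. Cring.
  - now apply (@is_series_plus C_AbsRing C_NormedModule).
Qed.

Lemma psum_scal (c : C) (x : nat -> C) (z u : C) :
  psum x z u -> psum (fun k => c * x k)%C z (c * u)%C.
Proof.
  intros Hx. unfold psum.
  apply (is_series_ext (fun k => @scal C_AbsRing C_NormedModule c (x k * z ^ k)%C)).
  - intros k. change (scal ?a ?b) with (a * b)%C. Cring.
  - now apply (@is_series_scal_l C_AbsRing C_NormedModule).
Qed.

Definition shift (x : nat -> C) (k : nat) : C :=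
  match k with O => RtoC 0 | S k' => x k' end.

Lemma psum_shift (x : nat -> C) (z w : C) : psum x z w -> psum (shift x) z (z * w)%C.
Proof.
  intros H. unfold psum. apply is_series_decr_1. simpl.
  apply (is_series_ext (fun k => @scal C_AbsRing C_NormedModule z (x k * z ^ k)%C)).
  - intros k. change (scal ?a ?b) with (a * b)%C. Cring.
  - match goal with |- is_series _ ?l =>
      replace l with (@scal C_AbsRing C_NormedModule z w) end.
    + now apply (@is_series_scal_l C_AbsRing C_NormedModule).
    + change (plus ?a ?b) with (a + b)%C. change (opp ?a) with (- a)%C.
      change (scal ?a ?b) with (a * b)%C. Cring.
Qed.

Lemma psum_shift_iter (n : nat) (x : nat -> C) (z w : C) :
  psum x z w -> psum (Nat.iter n shift x) z (z ^ n * w)%C.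
Proof.
  intros H. induction n as [|n IH]; simpl.
  - now rewrite Cmult_1_l.
  - rewrite <- Cmult_assoc. now apply psum_shift.
Qed.

Lemma shift_iter_lt (n k : nat) (x : nat -> C) :
  (k < n)%nat -> Nat.iter n shift x k = RtoC 0.
Proof.
  revert k. induction n as [|n IH]; intros k Hk; [lia|].
  destruct k as [|k]; [reflexivity|]. simpl. apply IH. lia.
Qed.

Lemma shift_iter_eq (n : nat) (x : nat -> C) : Nat.iter n shift x n = x O.
Proof. induction n as [|n IH]; [reflexivity|exact IH]. Qed.

(** * Elementary limit arguments and finite real sums *)

Lemma pow_bernoulli (d : R) (m : nat) : 0 <= d <= 1 -> 1 - INR m * d <= (1 - d) ^ m.
Proof.
  intros Hd. induction m as [|m IH]; [simpl; lra|].
  rewrite S_INR. simpl.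
  set (t := (1 - d) ^ m) in *.
  assert (0 <= INR m) by apply pos_INR.
  assert (0 <= INR m * d * d) by (repeat apply Rmult_le_pos; lra).
  assert (0 <= (1 - d) * (t - (1 - INR m * d))) by (apply Rmult_le_pos; lra).
  nra.
Qed.

Lemma le_of_pow_mult_le (m : nat) (A B : R) :
  0 <= B -> (forall r, 0 < r < 1 -> r ^ m * A <= B) -> A <= B.
Proof.
  intros HB H. apply Rnot_lt_le. intros HAB.
  assert (Hm : 0 <= INR m) by apply pos_INR.
  (* Chosen so that [m d A < A - B]; Bernoulli then gives [(1 - d)^m A > B], against the hypothesis
     at [r = 1 - d]. *)
  set (d := (A - B) / ((INR m + 2) * A)).
  assert (Hd : d * ((INR m + 2) * A) = A - B) by (unfold d; field; split; lra).
  assert (Hd0 : 0 < d) by (unfold d; apply Rdiv_lt_0_compat; nra).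
  assert (HA : 2 * A <= (INR m + 2) * A) by nra.
  assert (Hd1 : d < 1).
  { unfold d. apply (Rmult_lt_reg_r ((INR m + 2) * A)); [nra|].
    unfold Rdiv. rewrite Rmult_assoc, Rinv_l; nra. }
  specialize (H (1 - d) ltac:(lra)).
  pose proof (pow_bernoulli d m ltac:(lra)) as Hb.
  assert (0 <= A * ((1 - d) ^ m - (1 - INR m * d))) by (apply Rmult_le_pos; lra).
  nra.
Qed.

(** The error term is what squaring [|P| <= V + e] produces when [V <= K]. *)
Lemma le_of_quadratic_eps (X Y K : R) :
  0 <= K -> (forall e, 0 < e -> X <= Y + (2 * e * K + e ^ 2)) -> X <= Y.
Proof.
  intros HK H. apply Rnot_lt_le. intros HXY.
  set (e := Rmin 1 ((X - Y) / (2 * (2 * K + 1)))).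
  assert (He2 : (X - Y) / (2 * (2 * K + 1)) * (2 * (2 * K + 1)) = X - Y) by (field; lra).
  assert (0 < (X - Y) / (2 * (2 * K + 1))) by (apply Rdiv_lt_0_compat; lra).
  assert (He : 0 < e) by (unfold e; apply Rmin_glb_lt; lra).
  assert (e <= 1) by apply Rmin_l.
  assert (e <= (X - Y) / (2 * (2 * K + 1))) by apply Rmin_r.
  specialize (H e He). nra.
Qed.

Lemma sum_n_le_compat (u v : nat -> R) (n : nat) :
  (forall k, (k <= n)%nat -> u k <= v k) -> sum_n u n <= sum_n v n.
Proof.
  intros H. induction n as [|n IH]; [rewrite !sum_O; now apply H|].
  rewrite !sum_Sn. change (plus ?a ?b) with (a + b).
  apply Rplus_le_compat; [apply IH; intros; apply H|apply H]; lia.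
Qed.

Lemma sum_n_nonneg (u : nat -> R) (n : nat) : (forall k, 0 <= u k) -> 0 <= sum_n u n.
Proof.
  intros H. induction n as [|n IH]; [rewrite sum_O; auto|].
  rewrite sum_Sn. change (plus ?a ?b) with (a + b). specialize (H (S n)). lra.
Qed.

Lemma sum_n_mono_index (u : nat -> R) (n m : nat) :
  (forall k, 0 <= u k) -> (n <= m)%nat -> sum_n u n <= sum_n u m.
Proof.
  intros H Hnm. induction Hnm as [|m Hnm IH]; [lra|].
  rewrite sum_Sn. change (plus ?a ?b) with (a + b). specialize (H (S m)). lra.
Qed.

(** * Coefficient inequalities for bounded functions *)

Lemma sum_binomial_roots (t : C) (n N' : nat) :
  (0 < n <= N')%nat ->
  let w := root_of_unity (S N') in
  sum_n (fun j => Cmod (1 + t * (w ^ j) ^ n)%C ^ 2) N' = INR (S N') * (1 + Cmod t ^ 2).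
Proof.
  intros Hn w. apply RtoC_inj.
  assert (Hw : forall j k, ((w ^ j) ^ k * Cconj ((w ^ j) ^ k) = 1)%C).
  { intros j k. rewrite <- Cmod2_conj, !Cmod_pow. unfold w, root_of_unity.
    now rewrite Cmod_cos_sin, !pow1. }
  (* The cross terms of [|1 + t z^n|^2] average to zero: the constant 1 is the monomial of degree 0,
     orthogonal to [z^n]. *)
  assert (H0 : csum (fun j => Cconj (t * (w ^ j) ^ n)%C) N' = RtoC 0).
  { rewrite (sum_n_ext _ (fun j => (((w ^ j) ^ 0 * Cconj ((w ^ j) ^ n)) * Cconj t)%C)).
    - rewrite csum_mult_r. unfold w. rewrite roots_orthogonal by lia. Cring.
    - intros j. rewrite Cmult_conj. simpl. Cring. }
  rewrite RtoC_sum_n.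
  rewrite (sum_n_ext _ (fun j => (RtoC (1 + Cmod t ^ 2) +
     (Cconj (t * (w ^ j) ^ n) + Cconj (Cconj (t * (w ^ j) ^ n))))%C)).
  - rewrite !csum_plus, (csum_conj (fun j => Cconj (t * (w ^ j) ^ n)%C)), H0, Cconj_0.
    rewrite <- RtoC_sum_n, sum_n_const. Cring.
  - intros j. rewrite Cmod2_conj, Cconj_conj, Cplus_conj, RtoC_plus, Cmod2_conj.
    transitivity (1 + (t * Cconj t) * ((w ^ j) ^ n * Cconj ((w ^ j) ^ n)) +
      (Cconj (t * (w ^ j) ^ n) + t * (w ^ j) ^ n))%C.
    + replace (Cconj 1) with (RtoC 1) by (apply injective_projections; simpl; ring).
      rewrite Cmult_conj. Cring.
    + rewrite Hw. Cring.
Qed.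

(** The pointwise bound is squared and averaged over the roots of unity on the circle of radius [r]:
    Parseval evaluates the left side, [sum_binomial_roots] the right side. Then the truncation error
    [e] tends to 0 and [r] to 1. *)
Lemma binomial_bounded_coef (y : nat -> C) (c : C) (n : nat) :
  (0 < n)%nat ->
  (forall z, Cmod z < 1 -> exists w, psum y z w /\ Cmod w <= Cmod (1 + c * z ^ n)%C) ->
  sum_n (fun k => Cmod (y k) ^ 2) n <= 1 + Cmod c ^ 2.
Proof.
  intros Hn Hy.
  pose proof (Cmod_ge_0 c) as Hc.
  (* On the circle of radius [r] the coefficient [y_k] contributes [|y_k|^2 r^(2k)], which is at
     least [|y_k|^2 r^(2n)] for [k <= n]. *)
  apply (le_of_pow_mult_le (2 * n)); [nra|].
  intros r Hr.
  apply (le_of_quadratic_eps _ _ (1 + Cmod c)); [lra|].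
  intros e He.
  destruct (psum_uniform y r e) as [M0 HM0]; auto.
  { intros z Hz. destruct (Hy z Hz) as [w [Hw _]]. now exists w. }
  (* At least [M0] for the truncation, and at least [n] so that [z^n] is not aliased by the [M + 1]
     sample points. *)
  set (M := (M0 + n)%nat).
  set (w := root_of_unity (S M)).
  set (P := fun j => csum (fun k => (y k * r ^ k) * (w ^ j) ^ k)%C M).
  assert (Hwj : forall j, Cmod (w ^ j)%C = 1).
  { intros j. rewrite Cmod_pow. unfold w, root_of_unity. now rewrite Cmod_cos_sin, pow1. }
  assert (HP : forall j, Cmod (P j) ^ 2 <=
     Cmod (1 + (c * r ^ n) * (w ^ j) ^ n)%C ^ 2 + (2 * e * (1 + Cmod c) + e ^ 2)).
  { intros j.
    set (z := (r * w ^ j)%C).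
    assert (Hz : Cmod z = r).
    { unfold z. rewrite Cmod_mult, Hwj, Cmod_R, Rabs_pos_eq; lra. }
    assert (Ez : forall k, (z ^ k = r ^ k * (w ^ j) ^ k)%C).
    { intros k. unfold z. now rewrite Cpow_mult_l. }
    destruct (Hy z ltac:(lra)) as [v [Hv Hvb]].
    pose proof (HM0 M z v ltac:(lia) Hz Hv) as HB.
    assert (EP : P j = csum (fun k => (y k * z ^ k)%C) M).
    { apply sum_n_ext. intros k. rewrite Ez. Cring. }
    rewrite <- EP in HB. rewrite Ez, Cmult_assoc in Hvb.
    assert (HV : Cmod (1 + (c * r ^ n) * (w ^ j) ^ n)%C <= 1 + Cmod c).
    { eapply Rle_trans; [apply Cmod_triangle|].
      rewrite Cmod_1, !Cmod_mult, !Cmod_pow, Cmod_R, Rabs_pos_eq by lra.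
      replace (Cmod w ^ j) with 1 by (rewrite <- Cmod_pow; now rewrite Hwj).
      rewrite pow1.
      assert (r ^ n <= 1) by (rewrite <- (pow1 n); apply pow_incr; lra).
      nra. }
    pose proof (Cmod_ge_0 (P j)).
    pose proof (Cmod_ge_0 (1 + (c * r ^ n) * (w ^ j) ^ n)%C).
    set (V := Cmod (1 + (c * r ^ n) * (w ^ j) ^ n)%C) in *.
    assert (Cmod (P j) <= V + e) by lra. nra. }
  assert (HN : 0 < INR (S M)) by (apply lt_0_INR; lia).
  pose proof (sum_n_le_compat _ _ M (fun j _ => HP j)) as HS.
  rewrite (@sum_n_plus R_AbelianMonoid) in HS.
  change (plus ?a ?b) with (a + b) in HS.
  rewrite sum_n_const in HS.
  unfold w in HS. rewrite sum_binomial_roots in HS by lia.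
  unfold P, w in HS.
  rewrite (discrete_parseval (fun k => y k * r ^ k)%C M M (le_n _)) in HS.
  rewrite <- !Rmult_plus_distr_l in HS.
  apply Rmult_le_reg_l in HS; [|exact HN].
  apply Rle_trans with (sum_n (fun k => Cmod (y k * r ^ k)%C ^ 2) n).
  - rewrite <- (@sum_n_mult_l R_Ring). apply sum_n_le_compat. intros k Hk.
    change (mult ?a ?b) with (a * b).
    rewrite Cmod_mult, Cmod_pow, Cmod_R, Rabs_pos_eq by lra.
    rewrite Rpow_mult_distr, <- pow_mult, (Nat.mul_comm k 2), Rmult_comm.
    apply Rmult_le_compat_l; [apply pow2_ge_0|].
    replace (2 * n)%nat with (2 * k + 2 * (n - k))%nat by lia.
    rewrite pow_add. rewrite <- (Rmult_1_r (r ^ (2 * k))) at 2.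
    apply Rmult_le_compat_l; [apply pow_le; lra|].
    rewrite <- (pow1 (2 * (n - k))). apply pow_incr. lra.
  - eapply Rle_trans; [apply (sum_n_mono_index _ n M)|].
    + intros k. apply pow2_ge_0.
    + lia.
    + eapply Rle_trans; [exact HS|].
      rewrite Cmod_mult, Cmod_pow, Cmod_R, Rabs_pos_eq by lra.
      assert (0 <= r ^ n <= 1).
      { split; [apply pow_le; lra|]. rewrite <- (pow1 n); apply pow_incr; lra. }
      assert (0 <= Cmod c * r ^ n <= Cmod c) by nra.
      assert ((Cmod c * r ^ n) ^ 2 <= Cmod c ^ 2) by (apply pow_incr; lra).
      lra.
Qed.

(* [binomial_bounded_coef] for [f(z) (1 + c z^(n+1))], with the optimal
   [c = x_(n+1) conj(x_0) / (1 - |x_0|^2)]. *)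
Lemma coef_sq_bound (x : nat -> C) (n : nat) :
  admissible x ->
  Cmod (x (S n)) ^ 2 <=
    (1 - Cmod (x O) ^ 2) * (1 - sum_n (fun k => Cmod (x k) ^ 2) n).
Proof.
  intros Hx. rewrite admissible_psum in Hx.
  set (a2 := Cmod (x O) ^ 2).
  assert (HH : forall c : C,
    sum_n (fun k => Cmod (x k) ^ 2) n + Cmod (x (S n) + c * x O)%C ^ 2 <= 1 + Cmod c ^ 2).
  { intros c.
    set (y := fun k => (x k + c * Nat.iter (S n) shift x k)%C).
    assert (Hy : sum_n (fun k => Cmod (y k) ^ 2) (S n) <= 1 + Cmod c ^ 2).
    { apply binomial_bounded_coef; [lia|]. intros z Hz.
      destruct (Hx z Hz) as [w [Hw Hb]].
      exists (w + c * (z ^ S n * w))%C. split.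
      - apply psum_plus; [exact Hw|]. apply psum_scal. now apply psum_shift_iter.
      - replace (w + c * (z ^ S n * w))%C with ((1 + c * z ^ S n) * w)%C by ring.
        rewrite Cmod_mult. pose proof (Cmod_ge_0 (1 + c * z ^ S n)%C). nra. }
    rewrite sum_Sn in Hy. change (plus ?a ?b) with (a + b) in Hy.
    unfold y at 2 in Hy. rewrite shift_iter_eq in Hy.
    eapply Rle_trans; [|exact Hy]. apply Rplus_le_compat_r, sum_n_le_compat.
    intros k Hk. unfold y. rewrite shift_iter_lt by lia.
    replace (x k + c * 0)%C with (x k) by ring. lra. }
  pose proof (HH 0%C) as H0.
  rewrite Cmod_0 in H0. replace (x (S n) + 0 * x O)%C with (x (S n)) in H0 by ring.
  set (E := sum_n (fun k => Cmod (x k) ^ 2) n) in *.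
  assert (Ha2E : a2 <= E).
  { unfold E, a2. rewrite <- (sum_O (fun k => Cmod (x k) ^ 2)).
    apply sum_n_mono_index; [intros; apply pow2_ge_0 | lia]. }
  pose proof (pow2_ge_0 (Cmod (x (S n)))) as Hn2.
  destruct (Rlt_or_le a2 1) as [Ha|Ha].
  (* Here [1 <= a2 <= E], so the right side is a product of two nonpositive factors, while [c = 0]
     gives [|x_(n+1)|^2 <= 1 - E <= 0]. *)
  2:{ assert (0 <= (1 - a2) * (1 - E)) by nra. nra. }
  set (c := (x (S n) * Cconj (x O) / RtoC (1 - a2))%C).
  assert (Hne : RtoC (1 - a2) <> 0) by (intros F; apply RtoC_inj in F; lra).
  pose proof (HH c) as Hc.
  assert (E1 : (x (S n) + c * x O = x (S n) / RtoC (1 - a2))%C).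
  { unfold c. transitivity (x (S n) * (RtoC (1 - a2) + x O * Cconj (x O)) / RtoC (1 - a2))%C.
    - field. exact Hne.
    - rewrite <- Cmod2_conj. fold a2. rewrite <- RtoC_plus.
      replace (1 - a2 + a2) with 1 by ring. field. exact Hne. }
  rewrite E1 in Hc. unfold c in Hc.
  rewrite !Cmod_div, Cmod_mult, Cmod_conj, Cmod_R, Rabs_pos_eq in Hc by (auto; lra).
  (* For this [c] the gain [|x_(n+1) + c x_0|^2 - |c|^2] equals [|x_(n+1)|^2 / (1 - a2)]. *)
  assert (E2 : (Cmod (x (S n)) / (1 - a2)) ^ 2 -
     (Cmod (x (S n)) * Cmod (x O) / (1 - a2)) ^ 2 = Cmod (x (S n)) ^ 2 / (1 - a2)).
  { transitivity (Cmod (x (S n)) ^ 2 * (1 - Cmod (x O) ^ 2) / (1 - a2) ^ 2).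
    - field. lra.
    - fold a2. field. lra. }
  assert (H : Cmod (x (S n)) ^ 2 / (1 - a2) <= 1 - E) by lra.
  apply (Rmult_le_compat_l (1 - a2)) in H; [|lra].
  replace ((1 - a2) * (Cmod (x (S n)) ^ 2 / (1 - a2))) with (Cmod (x (S n)) ^ 2) in H
    by (field; lra).
  exact H.
Qed.

Lemma admissible_sum_sq (x : nat -> C) (n : nat) :
  admissible x -> sum_n (fun k => Cmod (x k) ^ 2) n <= 1.
Proof.
  intros Hx. rewrite admissible_psum in Hx.
  (* The index is raised by one because [binomial_bounded_coef] asks for a positive one. *)
  apply Rle_trans with (sum_n (fun k => Cmod (x k) ^ 2) (S n)).
  { apply sum_n_mono_index; [intros; apply pow2_ge_0 | lia]. }
  replace 1 with (1 + Cmod 0 ^ 2) by (rewrite Cmod_0; ring).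
  apply binomial_bounded_coef; [lia|]. intros z Hz.
  destruct (Hx z Hz) as [w [Hw Hb]]. exists w; split; [exact Hw|].
  replace (1 + 0 * z ^ S n)%C with (RtoC 1) by ring. now rewrite Cmod_1.
Qed.

(* The left-hand side is [sum |x_k|^2 rho^k] plus a potential that does not increase
   with [n], by [coef_sq_bound]. *)
Lemma weighted_sum_sq_potential (x : nat -> C) (rho : R) (n : nat) :
  admissible x -> Cmod (x O) < 1 -> 0 < rho <= 1 ->
  let a2 := Cmod (x O) ^ 2 in
  sum_n (fun k => Cmod (x k) ^ 2 * rho ^ k) n - a2 +
    (1 - sum_n (fun k => Cmod (x k) ^ 2) n) * rho ^ S n * (1 - a2) / (1 - a2 * rho)
  <= rho * (1 - a2) ^ 2 / (1 - a2 * rho).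
Proof.
  intros Hx Ha Hr a2.
  assert (Ha2 : 0 <= a2 < 1) by (unfold a2; pose proof (Cmod_ge_0 (x O)); nra).
  assert (Hd : 0 < 1 - a2 * rho) by nra.
  induction n as [|n IH].
  - rewrite !sum_O. fold a2. right. simpl. field. lra.
  - eapply Rle_trans; [|exact IH].
    rewrite !sum_Sn. change (plus ?a ?b) with (a + b).
    pose proof (coef_sq_bound x n Hx) as Hk. fold a2 in Hk.
    set (t := Cmod (x (S n)) ^ 2) in *.
    set (E := sum_n (fun k => Cmod (x k) ^ 2) n) in *.
    set (V := sum_n _ n).
    assert (Hp : 0 < rho ^ S n) by (apply pow_lt; lra).
    change (rho ^ S (S n)) with (rho * rho ^ S n).
    set (s := rho ^ S n) in *.
    (* The potential is the largest possible remaining tail. If [coef_sq_bound] were always an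
       equality, the defect [1 - E] would shrink by the factor [a2] at each step, and the weighted
       tail would sum to [(1 - E) rho^(n+1) (1 - a2) / (1 - a2 rho)]. The increment is therefore
       minus a nonnegative multiple of the slack in [coef_sq_bound]. *)
    apply Rminus_le.
    replace (_ - _) with (- (s * (1 - rho) / (1 - a2 * rho) * ((1 - a2) * (1 - E) - t)))
      by (field; lra).
    assert (0 <= s * (1 - rho) / (1 - a2 * rho)) by (apply Rdiv_le_0_compat; nra).
    nra.
Qed.

Lemma weighted_sum_sq_bound (x : nat -> C) (rho : R) (n : nat) :
  admissible x -> Cmod (x O) < 1 -> 0 < rho <= 1 ->
  sum_n (fun k => Cmod (x (S k)) ^ 2 * rho ^ S k) n
  <= rho * (1 - Cmod (x O) ^ 2) ^ 2 / (1 - Cmod (x O) ^ 2 * rho).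
Proof.
  intros Hx Ha Hr.
  eapply Rle_trans; [|apply (weighted_sum_sq_potential x rho (S n) Hx Ha Hr)].
  assert (E : sum_n (fun k => Cmod (x k) ^ 2 * rho ^ k) (S n) =
              Cmod (x O) ^ 2 + sum_n (fun k => Cmod (x (S k)) ^ 2 * rho ^ S k) n).
  { unfold sum_n. rewrite sum_Sn_m by lia. rewrite <- sum_n_m_S.
    change (plus ?a ?b) with (a + b). f_equal. apply Rmult_1_r. }
  rewrite E.
  pose proof (admissible_sum_sq x (S n) Hx).
  set (B := sum_n (fun k => Cmod (x k) ^ 2) (S n)) in *.
  set (a2 := Cmod (x O) ^ 2) in *.
  assert (Ha2 : 0 <= a2 < 1) by (unfold a2; pose proof (Cmod_ge_0 (x O)); nra).
  assert (a2 * rho <= a2 * 1) by (apply Rmult_le_compat_l; lra).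
  assert (0 < rho ^ S (S n)) by (apply pow_lt; lra).
  assert (0 <= (1 - B) * rho ^ S (S n) * (1 - a2) / (1 - a2 * rho)).
  { apply Rdiv_le_0_compat; [|lra].
    apply Rmult_le_pos; [apply Rmult_le_pos|]; lra. }
  lra.
Qed.

(** * Bounding the majorant series *)

Lemma sum_n_cauchy_schwarz (u v : nat -> R) (n : nat) :
  sum_n (fun k => u k * v k) n ^ 2 <=
  sum_n (fun k => u k ^ 2) n * sum_n (fun k => v k ^ 2) n.
Proof.
  induction n as [|n IH].
  - rewrite !sum_O. right. ring.
  - assert (HU : 0 <= sum_n (fun k => u k ^ 2) n) by (apply sum_n_nonneg; intros; apply pow2_ge_0).
    assert (HV : 0 <= sum_n (fun k => v k ^ 2) n) by (apply sum_n_nonneg; intros; apply pow2_ge_0).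
    rewrite !sum_Sn.
    repeat match goal with |- context [@plus ?G ?a ?b] => change (@plus G a b) with (a + b) end.
    set (S := sum_n _ n) in *.
    set (U := sum_n (fun k => u k ^ 2) n) in *.
    set (V := sum_n (fun k => v k ^ 2) n) in *.
    set (a := u (Datatypes.S n)). set (b := v (Datatypes.S n)).
    (* Compare squares: [4 S^2 a^2 b^2 <= 4 U V a^2 b^2 <= (U b^2 + V a^2)^2]. *)
    assert (H : S * (2 * a * b) <= U * b ^ 2 + V * a ^ 2).
    { apply Rle_trans with (Rabs (S * (2 * a * b))); [apply Rle_abs|].
      rewrite <- (Rabs_pos_eq (U * b ^ 2 + V * a ^ 2)) by nra.
      apply Rsqr_le_abs_0. unfold Rsqr.
      assert (0 <= (U * b ^ 2 - V * a ^ 2) ^ 2) by apply pow2_ge_0.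
      assert (0 <= (U * V - S ^ 2) * (a * b) ^ 2)
        by (apply Rmult_le_pos; [lra|apply pow2_ge_0]).
      nra. }
    nra.
Qed.

Lemma sum_n_geom_le (t : R) (n : nat) :
  0 <= t < 1 -> sum_n (fun k => t ^ S k) n <= t / (1 - t).
Proof.
  intros Ht.
  assert (E : sum_n (fun k => t ^ S k) n = t / (1 - t) - t ^ S (S n) / (1 - t)).
  { induction n as [|n IH].
    - rewrite sum_O. simpl. field. lra.
    - rewrite sum_Sn, IH. change (plus ?a ?b) with (a + b). simpl. field. lra. }
  rewrite E.
  assert (0 <= t ^ S (S n) / (1 - t)) by (apply Rdiv_le_0_compat; [apply pow_le|]; lra).
  lra.
Qed.

(** Cauchy-Schwarz is applied to [(|x_k| sqrt rho ^ k) * (r / sqrt rho) ^ k]. The second factor has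
    squares that are geometric of ratio [r^2 / rho], whence the condition [r^2 < rho]. The last
    hypothesis is the resulting bound, squared and cleared of denominators. *)
Lemma majorant_sum_bound (x : nat -> C) (r rho B : R) (n : nat) :
  admissible x -> Cmod (x O) < 1 -> 0 <= r -> r ^ 2 < rho <= 1 -> 0 <= B ->
  (1 - Cmod (x O) ^ 2) ^ 2 * r ^ 2 <= B ^ 2 * ((1 - Cmod (x O) ^ 2 * rho) * (1 - r ^ 2 / rho)) ->
  sum_n (fun k => Cmod (x (S k)) * r ^ S k) n <= B.
Proof.
  intros Hx Ha Hr Hrho HB Hc.
  set (a2 := Cmod (x O) ^ 2) in *.
  assert (Ha2 : 0 <= a2 < 1) by (unfold a2; pose proof (Cmod_ge_0 (x O)); nra).
  pose proof (pow2_ge_0 r) as Hr2.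
  assert (H1 : 0 < 1 - a2 * rho).
  { assert (a2 * rho <= a2 * 1) by (apply Rmult_le_compat_l; lra). lra. }
  assert (Ht : 0 <= r ^ 2 / rho < 1).
  { split; [apply Rdiv_le_0_compat; lra|].
    apply (Rmult_lt_reg_r rho); [lra|]. unfold Rdiv. rewrite Rmult_assoc, Rinv_l; lra. }
  assert (Hs : sqrt rho * sqrt rho = rho) by (apply sqrt_sqrt; lra).
  assert (Hs0 : 0 < sqrt rho) by (apply sqrt_lt_R0; lra).
  rewrite (sum_n_ext _ (fun k => (Cmod (x (S k)) * sqrt rho ^ S k) * (r / sqrt rho) ^ S k)).
  2:{ intros k. rewrite Rmult_assoc, <- Rpow_mult_distr. do 2 f_equal. field. lra. }
  set (Sm := sum_n _ n).
  assert (HS2 : Sm ^ 2 <= B ^ 2).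
  { unfold Sm. eapply Rle_trans; [apply sum_n_cauchy_schwarz|].
    rewrite (sum_n_ext (fun k => (Cmod (x (S k)) * sqrt rho ^ S k) ^ 2)
               (fun k => Cmod (x (S k)) ^ 2 * rho ^ S k)).
    2:{ intros k. rewrite Rpow_mult_distr, <- pow_mult, Nat.mul_comm, pow_mult.
        replace (sqrt rho ^ 2) with rho by (simpl; lra). reflexivity. }
    rewrite (sum_n_ext (fun k => ((r / sqrt rho) ^ S k) ^ 2) (fun k => (r ^ 2 / rho) ^ S k)).
    2:{ intros k. rewrite <- pow_mult, Nat.mul_comm, pow_mult. f_equal.
        rewrite <- Hs at 2. field. lra. }
    pose proof (weighted_sum_sq_bound x rho n Hx Ha ltac:(lra)) as HW. fold a2 in HW.
    pose proof (sum_n_geom_le (r ^ 2 / rho) n Ht) as HG.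
    apply Rle_trans with (rho * (1 - a2) ^ 2 / (1 - a2 * rho) * (r ^ 2 / rho / (1 - r ^ 2 / rho))).
    - apply Rmult_le_compat; auto; apply sum_n_nonneg; intros k.
      + apply Rmult_le_pos; [apply pow2_ge_0 | apply pow_le; lra].
      + apply pow_le; lra.
    - set (t := r ^ 2 / rho) in *.
      apply (Rmult_le_reg_r ((1 - a2 * rho) * (1 - t))); [apply Rmult_lt_0_compat; lra|].
      replace (rho * (1 - a2) ^ 2 / (1 - a2 * rho) * (t / (1 - t)) * ((1 - a2 * rho) * (1 - t)))
        with ((1 - a2) ^ 2 * (rho * t)) by (field; lra).
      replace (rho * t) with (r ^ 2) by (unfold t; field; lra).
      exact Hc. }
  destruct (Rle_or_lt Sm B) as [H|H]; [exact H|]. nra.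
Qed.

Lemma is_series_of_bounded (u : nat -> R) (B : R) :
  (forall k, 0 <= u k) -> (forall n, sum_n u n <= B) ->
  exists s, is_series u s /\ 0 <= s <= B.
Proof.
  intros Hu HB.
  destruct (ex_finite_lim_seq_incr (sum_n u) B) as [s Hs]; auto.
  { intros n. apply sum_n_mono_index; auto. }
  exists s. split; [exact Hs|]. split.
  - apply (is_lim_seq_le (fun _ => 0) (sum_n u) (Finite 0) (Finite s)); auto.
    + intros n. now apply sum_n_nonneg.
    + apply is_lim_seq_const.
  - apply (is_lim_seq_le (sum_n u) (fun _ => B) (Finite s) (Finite B)); auto.
    apply is_lim_seq_const.
Qed.

(** * Real powers and the admissible size of the majorant *)

Lemma rpow_pos (x p : R) : 0 < x -> rpow x p = Rpower x p.
Proof. intros Hx. unfold rpow. destruct (Req_EM_T x 0); lra. Qed.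

Lemma rpow_0_l (p : R) : rpow 0 p = 0.
Proof. unfold rpow. destruct (Req_EM_T 0 0); lra. Qed.

Lemma rpow_1_l (p : R) : rpow 1 p = 1.
Proof. rewrite rpow_pos by lra. unfold Rpower. now rewrite ln_1, Rmult_0_r, exp_0. Qed.

Lemma rpow_gt_0 (x p : R) : 0 < x -> 0 < rpow x p.
Proof. intros Hx. rewrite rpow_pos by lra. apply exp_pos. Qed.

Lemma rpow_ge_0 (x p : R) : 0 <= rpow x p.
Proof. unfold rpow. destruct (Req_EM_T x 0); [lra|left; apply exp_pos]. Qed.

Lemma rpow_le (x y p : R) : 0 < p -> 0 <= x <= y -> rpow x p <= rpow y p.
Proof.
  intros Hp [[Hx|<-] Hy].
  - rewrite !rpow_pos by lra. apply Rle_Rpower_l; lra.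
  - rewrite rpow_0_l. apply rpow_ge_0.
Qed.

Lemma rpow_lt (x y p : R) : 0 < p -> 0 <= x < y -> rpow x p < rpow y p.
Proof.
  intros Hp [[Hx|<-] Hy].
  - rewrite !rpow_pos by lra. apply Rlt_Rpower_l; lra.
  - rewrite rpow_0_l. now apply rpow_gt_0.
Qed.

Lemma rpow_rpow (x p q : R) : 0 <= x -> rpow (rpow x p) q = rpow x (p * q).
Proof.
  intros [Hx|<-].
  - rewrite (rpow_pos (rpow x p)) by now apply rpow_gt_0.
    rewrite !rpow_pos by auto. apply Rpower_mult.
  - now rewrite !rpow_0_l.
Qed.

Lemma rpow_1_r (x : R) : 0 <= x -> rpow x 1 = x.
Proof.
  intros [Hx|<-]; [rewrite rpow_pos by auto; now apply Rpower_1 | apply rpow_0_l].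
Qed.

Lemma rpow_2_r (x : R) : 0 <= x -> rpow x 2 = x ^ 2.
Proof.
  intros [Hx|<-]; [|rewrite rpow_0_l; ring].
  rewrite rpow_pos by auto. change 2 with (INR 2). now apply Rpower_pow.
Qed.

(** The largest majorant sum compatible with [|x_0| = a]: it solves [a^p + beta^q = 1]. *)
Definition beta (p q a : R) : R := rpow (1 - rpow a p) (1 / q).

Lemma rpow_lt_1 (p a : R) : 0 < p -> 0 <= a < 1 -> rpow a p < 1.
Proof. intros Hp Ha. rewrite <- (rpow_1_l p). apply rpow_lt; lra. Qed.

Lemma beta_pow (p q a : R) :
  0 < p -> 0 < q -> 0 <= a < 1 -> rpow (beta p q a) q = 1 - rpow a p.
Proof.
  intros Hp Hq Ha. pose proof (rpow_lt_1 p a Hp Ha).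
  unfold beta. rewrite rpow_rpow by lra.
  replace (1 / q * q) with 1 by (field; lra). apply rpow_1_r; lra.
Qed.

Lemma beta_bounds (p q a : R) :
  0 < p -> 0 < q -> 0 <= a < 1 -> 0 < beta p q a <= 1.
Proof.
  intros Hp Hq Ha. pose proof (rpow_lt_1 p a Hp Ha). pose proof (rpow_ge_0 a p).
  unfold beta. split; [apply rpow_gt_0; lra|].
  apply Rle_trans with (rpow 1 (1 / q)); [|right; apply rpow_1_l].
  apply rpow_le; [apply Rdiv_lt_0_compat|]; lra.
Qed.

Lemma A_pq_beta (p q a : R) :
  A_pq p q a = beta p q a / (1 - a ^ 2 + a * beta p q a).
Proof. reflexivity. Qed.

(* [T <= S_pq p q a] with denominators and the square root cleared. *)
Definition below_S (p q a T : R) : Prop :=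
  T ^ 2 * (1 - a ^ 2) <= beta p q a ^ 2 * (1 - T ^ 2).

(** * Lower bounds for the Bohr radius *)

Lemma Cmod_coef_0_le_1 (x : nat -> C) : admissible x -> Cmod (x O) <= 1.
Proof.
  intros Hx. pose proof (admissible_sum_sq x 0 Hx) as H. rewrite sum_O in H.
  pose proof (Cmod_ge_0 (x O)). nra.
Qed.

Lemma bohr_ineq_of_majorant (p q T : R) (x : nat -> C) :
  0 < p -> 0 < q -> admissible x -> Cmod (x O) < 1 ->
  (forall r, 0 <= r < T -> exists rho, r ^ 2 < rho <= 1 /\
     (1 - Cmod (x O) ^ 2) ^ 2 * r ^ 2 <=
     beta p q (Cmod (x O)) ^ 2 * ((1 - Cmod (x O) ^ 2 * rho) * (1 - r ^ 2 / rho))) ->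
  bohr_ineq p q x T.
Proof.
  intros Hp Hq Hx Ha H z Hz.
  pose proof (Cmod_ge_0 (x O)) as Ha0.
  destruct (H (Cmod z)) as [rho [Hrho Hc]]; [split; [apply Cmod_ge_0|exact Hz]|].
  destruct (beta_bounds p q (Cmod (x O)) Hp Hq ltac:(lra)) as [Hb0 _].
  destruct (is_series_of_bounded (fun k => Cmod (x (S k)) * Cmod z ^ S k)
              (beta p q (Cmod (x O)))) as [s [Hs Hsb]].
  - intros k. apply Rmult_le_pos; [|apply pow_le]; apply Cmod_ge_0.
  - intros n. apply majorant_sum_bound with (rho := rho); auto; [apply Cmod_ge_0|lra].
  - exists s. split; [exact Hs|].
    assert (rpow s q <= rpow (beta p q (Cmod (x O))) q) by (apply rpow_le; lra).
    rewrite beta_pow in * by lra. lra.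
Qed.

Lemma bohr_ineq_below_S (p q T : R) (x : nat -> C) :
  0 < p -> 0 < q -> admissible x -> Cmod (x O) < 1 -> T <= 1 ->
  below_S p q (Cmod (x O)) T -> bohr_ineq p q x T.
Proof.
  intros Hp Hq Hx Ha HT HS.
  apply bohr_ineq_of_majorant; auto.
  intros r Hr. exists 1.
  unfold below_S in HS.
  pose proof (Cmod_ge_0 (x O)) as Ha0.
  set (a := Cmod (x O)) in *. set (b := beta p q a) in *.
  assert (Hr2 : r ^ 2 <= T ^ 2) by (apply pow_incr; lra).
  split; [nra|].
  assert (Ha2 : 0 <= 1 - a ^ 2) by nra.
  assert (r ^ 2 * (1 - a ^ 2) <= b ^ 2 * (1 - r ^ 2)).
  { pose proof (pow2_ge_0 b). nra. }
  replace (b ^ 2 * ((1 - a ^ 2 * 1) * (1 - r ^ 2 / 1)))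
    with ((1 - a ^ 2) * (b ^ 2 * (1 - r ^ 2))) by (field).
  replace ((1 - a ^ 2) ^ 2 * r ^ 2) with ((1 - a ^ 2) * (r ^ 2 * (1 - a ^ 2))) by ring.
  now apply Rmult_le_compat_l.
Qed.

Lemma A_denom_pos (p q a : R) :
  0 < p -> 0 < q -> 0 <= a < 1 -> 0 < 1 - a ^ 2 + a * beta p q a.
Proof. intros Hp Hq Ha. pose proof (beta_bounds p q a Hp Hq Ha). nra. Qed.

(** When [a r < 1], the right side says that the Moebius majorant [(1 - a^2) r / (1 - a r)] is at
    most [beta]. Both the lower and the upper bound by [A_pq] go through this form. *)
Lemma le_A_pq_iff (p q a r : R) :
  0 < p -> 0 < q -> 0 <= a < 1 ->
  (r <= A_pq p q a <-> (1 - a ^ 2) * r <= beta p q a * (1 - a * r)).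
Proof.
  intros Hp Hq Ha. rewrite A_pq_beta.
  pose proof (A_denom_pos p q a Hp Hq Ha) as Hd.
  rewrite <- Rle_div_r by exact Hd. split; intros; nra.
Qed.

Lemma bohr_ineq_below_A (p q T : R) (x : nat -> C) :
  0 < p -> 0 < q -> admissible x -> Cmod (x O) < 1 ->
  beta p q (Cmod (x O)) <= Cmod (x O) -> T <= A_pq p q (Cmod (x O)) -> bohr_ineq p q x T.
Proof.
  intros Hp Hq Hx Ha Hb HT.
  apply bohr_ineq_of_majorant; auto.
  intros r Hr.
  pose proof (Cmod_ge_0 (x O)) as Ha0.
  set (a := Cmod (x O)) in *.
  pose proof (beta_bounds p q a Hp Hq ltac:(lra)) as Hb0.
  pose proof (proj1 (le_A_pq_iff p q a r Hp Hq ltac:(lra)) ltac:(lra)) as HA.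
  (* [beta <= a] forces [A_pq a <= a], so [r < a] and [rho = r / a] is allowed. *)
  assert (Hra : r < a).
  { pose proof (proj1 (le_A_pq_iff p q a T Hp Hq ltac:(lra)) HT).
    apply Rlt_le_trans with T; [lra|].
    set (b := beta p q a) in *.
    assert ((1 - a ^ 2 + a * b) * T <= b) by lra.
    assert (0 <= (1 - a ^ 2) * (a - b)) by (apply Rmult_le_pos; nra).
    assert (b <= (1 - a ^ 2 + a * b) * a) by nra.
    apply (Rmult_le_reg_l (1 - a ^ 2 + a * b)); nra. }
  set (b := beta p q a) in *.
  (* At [r = 0] the choice [r / a] would give the forbidden weight 0. *)
  destruct (Req_dec r 0) as [->|Hr0].
  { exists 1. split; [lra|]. replace (b ^ 2 * _) with (b ^ 2 * (1 - a ^ 2)) by field.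
    replace ((1 - a ^ 2) ^ 2 * 0 ^ 2) with 0 by ring.
    apply Rmult_le_pos; nra. }
  exists (r / a).
  assert (Hra1 : r / a <= 1) by (apply Rle_div_l; lra).
  split; [split; [apply (Rmult_lt_reg_r a); [lra|];
                  unfold Rdiv; rewrite Rmult_assoc, Rinv_l; nra|exact Hra1]|].
  replace (1 - a ^ 2 * (r / a)) with (1 - a * r) by (field; lra).
  replace (1 - r ^ 2 / (r / a)) with (1 - a * r) by (field; lra).
  replace (b ^ 2 * ((1 - a * r) * (1 - a * r))) with ((b * (1 - a * r)) ^ 2) by ring.
  replace ((1 - a ^ 2) ^ 2 * r ^ 2) with (((1 - a ^ 2) * r) ^ 2) by ring.
  apply pow_incr. split; [apply Rmult_le_pos; nra|exact HA].
Qed.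

Lemma bohr_ineq_unimodular (p q T : R) (x : nat -> C) :
  admissible x -> Cmod (x O) = 1 -> bohr_ineq p q x T.
Proof.
  intros Hx Ha z _. exists 0. split.
  - assert (H0 : forall k, Cmod (x (S k)) = 0).
    { intros k. pose proof (coef_sq_bound x k Hx) as H. rewrite Ha in H.
      pose proof (Cmod_ge_0 (x (S k))). nra. }
    apply (is_series_ext (fun _ => 0)).
    + intros k. rewrite H0. symmetry. apply Rmult_0_l.
    + change (is_lim_seq (sum_n (fun _ : nat => 0)) (Finite 0)).
      apply (is_lim_seq_ext (fun _ => 0)).
      * intros n. symmetry. rewrite sum_n_const. apply Rmult_0_r.
      * apply is_lim_seq_const.
  (* The convention [rpow 0 q = 0] is decisive: the sum is [1 + 0]. *)
  - rewrite Ha, rpow_1_l, rpow_0_l. lra.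
Qed.

(** The value [a = |x_0|] alone decides which of the two criteria applies; [a = 1] leaves only
    constants. *)
Lemma R_C_ge (p q T : R) :
  0 < p -> 0 < q -> 0 <= T <= 1 ->
  (forall a, 0 <= a < 1 -> below_S p q a T \/ (beta p q a <= a /\ T <= A_pq p q a)) ->
  Rbar_le (Finite T) (R_C p q).
Proof.
  intros Hp Hq HT H.
  unfold R_C, Rbar_glb. destruct (Rbar_ex_glb _) as [g Hg]; simpl.
  apply (proj2 Hg (Finite T)). intros v [x [Hx ->]].
  unfold R_f, Rbar_lub. destruct (Rbar_ex_lub _) as [l Hl]; simpl.
  apply (proj1 Hl (Finite T)). exists T. split; [reflexivity|split; [lra|]].
  pose proof (Cmod_ge_0 (x O)) as Ha0.
  destruct (Cmod_coef_0_le_1 x Hx) as [Ha|Ha].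
  - destruct (H (Cmod (x O))) as [HS|[HA1 HA2]]; [lra| |].
    + apply bohr_ineq_below_S; auto; lra.
    + now apply bohr_ineq_below_A.
  - now apply bohr_ineq_unimodular.
Qed.

(** * Extremal functions and upper bounds *)

(* Taylor coefficients of [z |-> (a - z) / (1 - a z)]. *)
Definition mobius (a : R) (k : nat) : C :=
  match k with O => RtoC a | S k' => RtoC (- ((1 - a ^ 2) * a ^ k')) end.

Lemma one_minus_neq_0 (u : C) : Cmod u < 1 -> (1 - u)%C <> RtoC 0.
Proof.
  intros Hu E.
  assert (E2 : u = RtoC 1) by (transitivity (1 - (1 - u))%C; [ring|rewrite E; ring]).
  rewrite E2, Cmod_1 in Hu. lra.
Qed.

Lemma is_series_C_geom (u : C) :
  Cmod u < 1 ->
  @is_series C_AbsRing C_NormedModule (fun k => (u ^ k)%C) (/ (1 - u))%C.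
Proof.
  intros Hu.
  assert (Hne : (1 - u)%C <> RtoC 0) by now apply one_minus_neq_0.
  assert (Hm : 0 < Cmod (1 - u)%C) by now apply Cmod_gt_0.
  (* The remainder after the term of index [n] is [u^(n+1) / (1 - u)]. *)
  assert (Hlim : is_lim_seq (fun n => Cmod (/ (1 - u))%C * (Cmod u * Cmod u ^ n)) (Finite 0)).
  { replace (Finite 0) with (Rbar_mult (Finite (Cmod (/ (1 - u))%C * Cmod u)) (Finite 0))
      by (simpl; f_equal; ring).
    apply (is_lim_seq_ext (fun n => (Cmod (/ (1 - u))%C * Cmod u) * Cmod u ^ n)).
    { intros n. ring. }
    apply is_lim_seq_scal_l. apply is_lim_seq_geom.
    rewrite Rabs_pos_eq; [exact Hu|apply Cmod_ge_0]. }
  unfold is_series. apply filterlim_locally. intros eps.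
  apply is_lim_seq_spec in Hlim. destruct (Hlim eps) as [N HN].
  exists N. intros n Hn. specialize (HN n Hn).
  apply C_NormedModule_mixin_compat1.
  rewrite Rminus_0_r in HN. eapply Rle_lt_trans; [|exact HN].
  eapply Rle_trans; [|apply Rle_abs].
  rewrite <- Cmod_pow, <- !Cmod_mult, <- (Cmod_opp (/ (1 - u) * _)). right. f_equal.
  change (minus ?a ?b) with (a - b)%C.
  assert (E : forall t : C, ((u - 1) * t = u * u ^ n - 1)%C ->
    (- (/ (1 - u) * (u * u ^ n)))%C = (t - / (1 - u))%C).
  { intros t Ht.
    replace t with (- ((u - 1) * t) / (1 - u))%C by (field; exact Hne).
    rewrite Ht. field. exact Hne. }
  symmetry. apply E. rewrite csum_geom. reflexivity.
Qed.

Lemma Cmult_lt_1 (a : R) (z : C) : 0 <= a < 1 -> Cmod z < 1 -> Cmod (a * z)%C < 1.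
Proof.
  intros Ha Hz. rewrite Cmod_mult, Cmod_R, Rabs_pos_eq by lra.
  pose proof (Cmod_ge_0 z). nra.
Qed.

Lemma mobius_psum (a : R) (z : C) :
  0 <= a < 1 -> Cmod z < 1 -> psum (mobius a) z ((a - z) / (1 - a * z))%C.
Proof.
  intros Ha Hz. unfold psum.
  assert (Hu : Cmod (a * z)%C < 1) by now apply Cmult_lt_1.
  assert (Hne : (1 - a * z)%C <> RtoC 0) by now apply one_minus_neq_0.
  apply is_series_decr_1. cbn [mobius].
  apply (is_series_ext (fun k => @scal C_AbsRing C_NormedModule
           (- (RtoC (1 - a ^ 2) * z))%C ((a * z) ^ k)%C)).
  - intros k. change (scal ?a ?b) with (a * b)%C.
    rewrite Cpow_S, Cpow_mult_l, RtoC_opp, (RtoC_mult _ (a ^ k)), RtoC_pow. Cring.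
  - match goal with |- is_series _ ?l =>
      replace l with (@scal C_AbsRing C_NormedModule
           (- (RtoC (1 - a ^ 2) * z))%C (/ (1 - a * z))%C) end.
    + apply (@is_series_scal_l C_AbsRing C_NormedModule). now apply is_series_C_geom.
    + change (plus ?a ?b) with (a + b)%C. change (opp ?a) with (- a)%C.
      change (scal ?a ?b) with (a * b)%C.
      change (z ^ 0)%C with (RtoC 1). rewrite RtoC_minus, RtoC_pow.
      Cfield. exact Hne.
Qed.

Lemma mobius_admissible (a : R) : 0 <= a < 1 -> admissible (mobius a).
Proof.
  intros Ha. apply admissible_psum. intros z Hz.
  exists ((a - z) / (1 - a * z))%C. split; [now apply mobius_psum|].
  assert (Hu : Cmod (a * z)%C < 1) by now apply Cmult_lt_1.
  assert (Hne : (1 - a * z)%C <> RtoC 0) by now apply one_minus_neq_0.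
  rewrite Cmod_div by exact Hne.
  assert (Hm : 0 < Cmod (1 - a * z)%C) by now apply Cmod_gt_0.
  apply Rle_div_l; [exact Hm|]. rewrite Rmult_1_l.
  apply Rsqr_incr_0; [|apply Cmod_ge_0..].
  rewrite !Rsqr_pow2, !Cmod2_alt.
  pose proof (Cmod2_alt z) as H2. pose proof (Cmod_ge_0 z).
  destruct z as [u v]. simpl in *.
  (* This is [|1 - a z|^2 - |a - z|^2]. *)
  assert (0 <= (1 - a ^ 2) * (1 - (u ^ 2 + v ^ 2))) by (apply Rmult_le_pos; nra).
  nra.
Qed.

Lemma admissible_shift (x : nat -> C) : admissible x -> admissible (shift x).
Proof.
  rewrite !admissible_psum. intros Hx z Hz.
  destruct (Hx z Hz) as [w [Hw Hb]].
  exists (z * w)%C. split; [now apply psum_shift|].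
  rewrite Cmod_mult. pose proof (Cmod_ge_0 z). pose proof (Cmod_ge_0 w). nra.
Qed.

Lemma mobius_majorant (a r : R) :
  0 <= a < 1 -> 0 <= r -> a * r < 1 ->
  is_series (fun k => Cmod (mobius a (S k)) * r ^ S k) ((1 - a ^ 2) * r / (1 - a * r)).
Proof.
  intros Ha Hr Har.
  apply (is_series_ext (fun k => scal ((1 - a ^ 2) * r) ((a * r) ^ k))).
  - intros k. change (scal ?u ?v) with (u * v). unfold mobius.
    rewrite Cmod_R, Rabs_Ropp, Rabs_pos_eq
      by (apply Rmult_le_pos; [nra | apply pow_le; lra]).
    rewrite Rpow_mult_distr. simpl. ring.
  - unfold Rdiv.
    apply (@is_series_scal_l R_AbsRing R_NormedModule ((1 - a ^ 2) * r)).
    apply is_series_geom. rewrite Rabs_pos_eq; nra.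
Qed.

Lemma shift_majorant (x : nat -> C) (r s : R) :
  is_series (fun k => Cmod (x (S k)) * r ^ S k) s ->
  is_series (fun k => Cmod (shift x (S k)) * r ^ S k) (r * (Cmod (x O) + s)).
Proof.
  intros H. apply is_series_decr_1. simpl.
  apply (is_series_ext (fun k => scal r (Cmod (x (S k)) * r ^ S k))).
  - intros k. change (scal ?u ?v) with (u * v). simpl.
    Rring.
  - match goal with |- is_series _ ?l => replace l with (scal r s) end.
    + now apply (@is_series_scal_l R_AbsRing R_NormedModule).
    + change (plus ?u ?v) with (u + v). change (opp ?u) with (- u).
      change (scal ?u ?v) with (u * v).
      Rring.
Qed.

Lemma bohr_ineq_majorant_le (p q r0 r s : R) (x : nat -> C) :
  bohr_ineq p q x r0 -> 0 <= r < r0 ->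
  is_series (fun k => Cmod (x (S k)) * r ^ S k) s ->
  rpow (Cmod (x O)) p + rpow s q <= 1.
Proof.
  intros H Hr Hs.
  assert (Hz : Cmod r = r) by (rewrite Cmod_R, Rabs_pos_eq; lra).
  destruct (H (RtoC r)) as [s' [Hs' Hb]]; [rewrite Hz; lra|].
  rewrite Hz in Hs'.
  apply is_series_unique in Hs. apply is_series_unique in Hs'.
  rewrite <- Hs, Hs'. exact Hb.
Qed.

Lemma R_C_le (p q T : R) (x : nat -> C) :
  admissible x -> (forall r0, T < r0 -> ~ bohr_ineq p q x r0) ->
  Rbar_le (R_C p q) (Finite T).
Proof.
  intros Hx H.
  unfold R_C, Rbar_glb. destruct (Rbar_ex_glb _) as [g Hg]; simpl.
  apply Rbar_le_trans with (R_f p q x).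
  - apply (proj1 Hg (R_f p q x)). now exists x.
  - unfold R_f, Rbar_lub. destruct (Rbar_ex_lub _) as [l Hl]; simpl.
    apply (proj2 Hl (Finite T)). intros r [r0 [-> [Hr0 Hb]]]. simpl.
    apply Rnot_lt_le. intros HT. now apply (H r0).
Qed.

Lemma A_pq_pos (p q a : R) : 0 < p -> 0 < q -> 0 <= a < 1 -> 0 < A_pq p q a.
Proof.
  intros Hp Hq Ha. rewrite A_pq_beta.
  apply Rdiv_lt_0_compat; [now apply beta_bounds | now apply A_denom_pos].
Qed.

Lemma R_C_le_A_pq (p q a : R) :
  0 < p -> 0 < q -> 0 <= a < 1 -> Rbar_le (R_C p q) (Finite (A_pq p q a)).
Proof.
  intros Hp Hq Ha.
  apply R_C_le with (x := mobius a); [now apply mobius_admissible|].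
  intros r0 Hr0 HB.
  pose proof (A_pq_pos p q a Hp Hq Ha) as HA0.
  pose proof (beta_bounds p q a Hp Hq Ha) as Hb.
  assert (HaA : a * A_pq p q a < 1).
  { pose proof (proj1 (le_A_pq_iff p q a (A_pq p q a) Hp Hq Ha) (Rle_refl _)). nra. }
  set (A := A_pq p q a) in *.
  (* A radius strictly between [A] and [r0], close enough to [A] that [a r < 1] and the majorant
     still converges. *)
  set (r := A + Rmin (r0 - A) (1 - a * A) / 2).
  assert (Hm : 0 < Rmin (r0 - A) (1 - a * A)) by (apply Rmin_glb_lt; lra).
  assert (Hm1 := Rmin_l (r0 - A) (1 - a * A)).
  assert (Hm2 := Rmin_r (r0 - A) (1 - a * A)).
  assert (Hr : A < r < r0) by (unfold r; lra).
  assert (Har : a * r < 1) by (unfold r; nra).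
  pose proof (bohr_ineq_majorant_le _ _ _ r _ _ HB ltac:(lra)
                (mobius_majorant a r Ha ltac:(lra) Har)) as HI.
  set (s := (1 - a ^ 2) * r / (1 - a * r)) in HI.
  change (Cmod (mobius a O)) with (Cmod a) in HI.
  rewrite Cmod_R, Rabs_pos_eq in HI by lra.
  assert (Hs : s <= beta p q a).
  { apply Rnot_lt_le. intros Hlt.
    pose proof (rpow_lt _ s q Hq (conj (Rlt_le _ _ (proj1 Hb)) Hlt)) as Hlt'.
    rewrite beta_pow in Hlt' by lra. lra. }
  unfold s in Hs. apply Rle_div_l in Hs; [|lra].
  apply le_A_pq_iff in Hs; auto. fold A in Hs. lra.
Qed.

Lemma inv_sqrt_2_sqr : (1 / sqrt 2) ^ 2 = 1 / 2.
Proof.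
  assert (0 < sqrt 2) by (apply sqrt_lt_R0; lra).
  replace ((1 / sqrt 2) ^ 2) with (1 / (sqrt 2 * sqrt 2)) by (field; lra).
  now rewrite sqrt_sqrt by lra.
Qed.

Lemma inv_sqrt_2_bounds : 0 < 1 / sqrt 2 < 1.
Proof.
  assert (0 < 1 / sqrt 2) by (apply Rdiv_lt_0_compat; [|apply sqrt_lt_R0]; lra).
  pose proof inv_sqrt_2_sqr. nra.
Qed.

(** The factor [z] makes the constant coefficient 0, so the inequality only asks that the majorant
    be at most 1, whatever [p] and [q]. With [t = 1 / sqrt 2] the majorant
    [r (t + (1 - t^2) r / (1 - t r))] equals [2 t^2 = 1] at [r = t] and exceeds 1 beyond. *)
Lemma R_C_le_inv_sqrt_2 (p q : R) :
  0 < p -> 0 < q -> Rbar_le (R_C p q) (Finite (1 / sqrt 2)).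
Proof.
  intros Hp Hq.
  pose proof inv_sqrt_2_sqr as Ht2. pose proof inv_sqrt_2_bounds as Ht.
  generalize dependent (1 / sqrt 2). intros t Ht2 Ht.
  apply R_C_le with (x := shift (mobius t)).
  { apply admissible_shift, mobius_admissible. lra. }
  intros r0 Hr0 HB.
  set (r := t + Rmin (r0 - t) (1 - t) / 2).
  assert (Hm : 0 < Rmin (r0 - t) (1 - t)) by (apply Rmin_glb_lt; lra).
  assert (Hm1 := Rmin_l (r0 - t) (1 - t)).
  assert (Hm2 := Rmin_r (r0 - t) (1 - t)).
  assert (Hr : t < r < r0) by (unfold r; lra).
  assert (Hr1 : r < 1) by (unfold r; lra).
  assert (Htr : t * r < 1) by nra.
  pose proof (bohr_ineq_majorant_le _ _ _ r _ _ HB ltac:(lra)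
                (shift_majorant _ _ _ (mobius_majorant t r ltac:(lra) ltac:(lra) Htr))) as HI.
  change (Cmod (shift (mobius t) O)) with (Cmod 0) in HI.
  change (Cmod (mobius t O)) with (Cmod t) in HI.
  rewrite Cmod_0, rpow_0_l, Cmod_R, Rabs_pos_eq, Rplus_0_l in HI by lra.
  set (s := (1 - t ^ 2) * r / (1 - t * r)) in HI.
  assert (Hs : t < s).
  { unfold s. apply -> Rlt_div_r; [|lra].
    replace (t * (1 - t * r)) with (t - t ^ 2 * r) by ring. rewrite Ht2. lra. }
  assert (0 < (r - t) * (t + s)) by (apply Rmult_lt_0_compat; lra).
  assert (Hrs : 1 < r * (t + s)) by nra.
  pose proof (rpow_lt 1 _ q Hq (conj Rle_0_1 Hrs)) as Hlt. rewrite rpow_1_l in Hlt. lra.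
Qed.

(** * [S_pq] and the fixed point of [beta] *)

Lemma below_S_mono (p q a T T' : R) :
  0 <= a < 1 -> 0 <= T <= T' -> below_S p q a T' -> below_S p q a T.
Proof.
  unfold below_S. intros Ha HT H.
  assert (HT2 : T ^ 2 <= T' ^ 2) by (apply pow_incr; lra).
  apply Rle_trans with (T' ^ 2 * (1 - a ^ 2)); [apply Rmult_le_compat_r; nra|].
  eapply Rle_trans; [exact H|].
  apply Rmult_le_compat_l; [apply pow2_ge_0|lra].
Qed.

Lemma beta_sqr (p q a : R) :
  0 < p -> 0 < q -> 0 <= a < 1 -> rpow (1 - rpow a p) (2 / q) = beta p q a ^ 2.
Proof.
  intros Hp Hq Ha. pose proof (rpow_lt_1 p a Hp Ha).
  rewrite <- rpow_2_r by (left; now apply beta_bounds).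
  unfold beta. rewrite rpow_rpow by lra. f_equal. field. lra.
Qed.

Lemma S_pq_sqr (p q a : R) :
  0 < p -> 0 < q -> 0 <= a < 1 ->
  S_pq p q a ^ 2 = beta p q a ^ 2 / (1 - a ^ 2 + beta p q a ^ 2).
Proof.
  intros Hp Hq Ha. unfold S_pq. rewrite beta_sqr by auto.
  apply pow2_sqrt. pose proof (beta_bounds p q a Hp Hq Ha).
  apply Rdiv_le_0_compat; nra.
Qed.

Lemma below_S_iff (p q a T : R) :
  0 < p -> 0 < q -> 0 <= a < 1 -> 0 <= T -> (below_S p q a T <-> T <= S_pq p q a).
Proof.
  intros Hp Hq Ha HT. unfold below_S.
  pose proof (beta_bounds p q a Hp Hq Ha) as Hb.
  assert (Hd : 0 < 1 - a ^ 2 + beta p q a ^ 2) by nra.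
  assert (HS : 0 <= S_pq p q a) by apply sqrt_pos.
  transitivity (T ^ 2 <= S_pq p q a ^ 2).
  - rewrite S_pq_sqr, <- Rle_div_r by auto. split; intros; nra.
  - split; intros H.
    + apply Rnot_lt_le. intros Hlt. nra.
    + apply pow_incr. lra.
Qed.

(** The later lemmas use the root only in this form. *)
Lemma beta_fixed (p q ahat : R) :
  0 < q -> 0 < ahat < 1 -> rpow ahat p + rpow ahat q = 1 -> beta p q ahat = ahat.
Proof.
  intros Hq Ha Hroot. unfold beta.
  replace (1 - rpow ahat p) with (rpow ahat q) by lra.
  rewrite rpow_rpow by lra. replace (q * (1 / q)) with 1 by (field; lra).
  apply rpow_1_r. lra.
Qed.

Lemma beta_antitone (p q a b : R) :
  0 < p -> 0 < q -> 0 <= a <= b -> b < 1 -> beta p q b <= beta p q a.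
Proof.
  intros Hp Hq Hab Hb. unfold beta.
  pose proof (rpow_lt_1 p b Hp ltac:(lra)).
  pose proof (rpow_le a b p Hp Hab).
  apply rpow_le; [apply Rdiv_lt_0_compat|]; lra.
Qed.

Lemma beta_0_l (p q : R) : beta p q 0 = 1.
Proof. unfold beta. rewrite rpow_0_l, Rminus_0_r. apply rpow_1_l. Qed.

(** * Monotonicity of the logarithmic ratio *)

(* [exp (logratio a / q) = (1 - a^2) / beta a ^ 2], and [S_pq] is a decreasing function
   of that ratio. *)
Definition logratio (p q a : R) : R := q * ln (1 - a ^ 2) - 2 * ln (1 - Rpower a p).

(** This is [p a^(p-2) (1 - a^2) - q (1 - a^p)], the factor of the derivative of [logratio] that
    carries its sign. *)
Definition slope (p q a : R) : R := p * Rpower a (p - 2) + (q - p) * Rpower a p - q.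

Lemma Rpower_lt_1 (p a : R) : 0 < p -> 0 < a < 1 -> Rpower a p < 1.
Proof. intros Hp Ha. rewrite <- rpow_pos by lra. apply rpow_lt_1; lra. Qed.

Lemma is_derive_logratio (p q a : R) :
  0 < p -> 0 < a < 1 ->
  is_derive (logratio p q) a (2 * a / ((1 - a ^ 2) * (1 - Rpower a p)) * slope p q a).
Proof.
  intros Hp Ha. pose proof (Rpower_lt_1 p a Hp Ha) as H1.
  assert (Ha2 : 0 < 1 - a ^ 2) by nra.
  unfold logratio, slope.
  replace (Rpower a (p - 2)) with (Rpower a p / a ^ 2).
  2:{ unfold Rminus. rewrite Rpower_plus, Rpower_Ropp.
      rewrite <- (rpow_pos a 2), rpow_2_r by lra. reflexivity. }
  unfold Rpower in *. auto_derive.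
  - repeat split; simpl in *; lra.
  - field. simpl in *. repeat split; lra.
Qed.

Lemma logratio_mvt (p q a b : R) :
  0 < p -> 0 < a < b -> b < 1 ->
  exists c k, a < c < b /\ 0 < k /\ logratio p q b - logratio p q a = k * slope p q c.
Proof.
  intros Hp Ha Hb.
  destruct (MVT_cor2 (logratio p q)
    (fun c => 2 * c / ((1 - c ^ 2) * (1 - Rpower c p)) * slope p q c) a b) as [c [Hc1 Hc2]].
  - lra.
  - intros c Hc. apply is_derive_Reals. apply is_derive_logratio; lra.
  - exists c, (2 * c / ((1 - c ^ 2) * (1 - Rpower c p)) * (b - a)).
    pose proof (Rpower_lt_1 p c Hp ltac:(lra)).
    split; [exact Hc2|]. split; [|rewrite Hc1; ring].
    apply Rmult_lt_0_compat; [|lra]. apply Rdiv_lt_0_compat; [lra|].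
    apply Rmult_lt_0_compat; [nra|lra].
Qed.

Lemma ln_beta_sqr (p q a : R) :
  0 < p -> 0 < q -> 0 < a < 1 -> q * ln (beta p q a ^ 2) = 2 * ln (1 - Rpower a p).
Proof.
  intros Hp Hq Ha. rewrite <- beta_sqr by lra.
  pose proof (Rpower_lt_1 p a Hp Ha).
  rewrite (rpow_pos a) by lra. rewrite rpow_pos by lra.
  rewrite ln_Rpower. field. lra.
Qed.

Lemma ln_le_inv (x y : R) : 0 < x -> 0 < y -> ln x <= ln y -> x <= y.
Proof.
  intros Hx Hy [H|H]; [left; now apply ln_lt_inv | right; now apply ln_inv].
Qed.

(** The hypothesis is the logarithm of [below_S], times [q]. Its right side is [logratio ahat] for
    [T = ahat] and 0 for [T = 1 / sqrt 2], the two values it is used for. *)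
Lemma below_S_of_logratio (p q a T : R) :
  0 < p -> 0 < q -> 0 < a < 1 -> 0 < T < 1 ->
  logratio p q a <= q * (ln (1 - T ^ 2) - ln (T ^ 2)) -> below_S p q a T.
Proof.
  intros Hp Hq Ha HT HL. unfold below_S.
  pose proof (beta_bounds p q a Hp Hq ltac:(lra)) as Hb.
  assert (0 < T ^ 2) by nra. assert (0 < 1 - T ^ 2) by nra.
  assert (0 < 1 - a ^ 2) by nra. assert (0 < beta p q a ^ 2) by nra.
  apply ln_le_inv; [nra..|].
  rewrite !ln_mult by auto.
  unfold logratio in HL. rewrite <- (ln_beta_sqr p q a) in HL by auto.
  apply (Rmult_le_reg_l q); [auto|]. lra.
Qed.

Lemma logratio_fixed (p q ahat : R) :
  0 < p -> 0 < q -> 0 < ahat < 1 -> beta p q ahat = ahat ->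
  logratio p q ahat = q * (ln (1 - ahat ^ 2) - ln (ahat ^ 2)).
Proof.
  intros Hp Hq Ha Hb. unfold logratio. rewrite <- (ln_beta_sqr p q) by auto.
  rewrite Hb. ring.
Qed.

Lemma below_S_of_slope (p q ahat a : R) :
  0 < p -> 0 < q -> 0 < a < ahat -> ahat < 1 -> beta p q ahat = ahat ->
  (forall c, a < c < ahat -> 0 <= slope p q c) -> below_S p q a ahat.
Proof.
  intros Hp Hq Ha Hah Hb Hs.
  apply below_S_of_logratio; [auto..|lra|lra|].
  rewrite <- (logratio_fixed p q ahat) by (auto; lra).
  destruct (logratio_mvt p q a ahat Hp Ha Hah) as [c [k [Hc [Hk E]]]].
  specialize (Hs c Hc). nra.
Qed.

Lemma below_S_0 (p q b T : R) :
  0 < p -> 0 < q -> 0 < b < 1 -> 0 <= T <= 1 ->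
  (forall a, 0 < a < b -> below_S p q a T) -> below_S p q 0 T.
Proof.
  intros Hp Hq Hb HT H. unfold below_S. rewrite beta_0_l.
  apply Rnot_lt_le. intros HT2.
  set (e := Rmin (b / 2) ((2 * T ^ 2 - 1) / 2)).
  assert (Hg : 0 < 2 * T ^ 2 - 1) by nra.
  assert (He : 0 < e) by (unfold e; apply Rmin_glb_lt; lra).
  assert (He1 : e <= b / 2) by apply Rmin_l.
  assert (He2 : e <= (2 * T ^ 2 - 1) / 2) by apply Rmin_r.
  specialize (H e ltac:(lra)). unfold below_S in H.
  pose proof (beta_bounds p q e Hp Hq ltac:(lra)) as Hbe.
  assert (beta p q e ^ 2 <= 1) by nra.
  assert (0 <= 1 - T ^ 2 <= 1) by nra.
  assert (beta p q e ^ 2 * (1 - T ^ 2) <= 1 - T ^ 2) by nra.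
  assert (T ^ 2 * e ^ 2 <= e ^ 2) by nra.
  nra.
Qed.

(** * The sign of [slope] *)

Lemma exp_convex_chord (lam u : R) :
  0 <= lam <= 1 -> exp (lam * u) <= lam * exp u + (1 - lam).
Proof.
  intros Hl. set (m := lam * u).
  pose proof (exp_pos m) as Hm.
  (* The tangent line at [m] lies below [exp] at [u] and at 0; the weights [lam] and [1 - lam]
     average these points back to [m]. *)
  assert (H1 : exp m * (1 + (u - m)) <= exp u).
  { replace (exp u) with (exp m * exp (u - m)) by (rewrite <- exp_plus; f_equal; ring).
    apply Rmult_le_compat_l; [lra|]. apply exp_ineq1_le. }
  assert (H2 : exp m * (1 + (0 - m)) <= 1).
  { replace 1 with (exp m * exp (0 - m)) at 2
      by (rewrite <- exp_plus, <- exp_0; f_equal; ring).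
    apply Rmult_le_compat_l; [lra|]. apply exp_ineq1_le. }
  apply (Rmult_le_compat_l lam) in H1; [|lra].
  apply (Rmult_le_compat_l (1 - lam)) in H2; [|lra].
  assert (E : lam * (exp m * (1 + (u - m))) + (1 - lam) * (exp m * (1 + (0 - m))) = exp m).
  { unfold m at 2 4. ring. }
  lra.
Qed.

(** Apply [exp x >= 1 + x] to both powers with weights [p] and [2 - p]: the logarithms cancel, which
    settles [q = 2]. A smaller [q] adds [(2 - q) (1 - c^p) >= 0]. *)
Lemma slope_nonneg_small (p q c : R) :
  1 <= p <= 2 -> 1 <= q <= 2 -> 0 < c < 1 -> 0 <= slope p q c.
Proof.
  intros Hp Hq Hc. unfold slope.
  pose proof (Rpower_lt_1 p c ltac:(lra) Hc).
  assert (H1 := exp_ineq1_le ((p - 2) * ln c)).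
  assert (H2 := exp_ineq1_le (p * ln c)).
  fold (Rpower c (p - 2)) in H1. fold (Rpower c p) in H2.
  apply (Rmult_le_compat_l p) in H1; [|lra].
  apply (Rmult_le_compat_l (2 - p)) in H2; [|lra].
  assert (0 <= (2 - q) * (1 - Rpower c p)) by (apply Rmult_le_pos; lra).
  lra.
Qed.

Lemma slope_factor (p q a : R) :
  0 < a -> slope p q a =
    Rpower a (p - 2) * (p - (p - q) * exp (2 * ln a) - q * exp ((2 - p) * ln a)).
Proof.
  intros Ha. unfold slope, Rpower.
  replace (exp (p * ln a)) with (exp ((p - 2) * ln a) * exp (2 * ln a))
    by (rewrite <- exp_plus; f_equal; ring).
  assert (E : exp ((p - 2) * ln a) * exp ((2 - p) * ln a) = 1)
    by (rewrite <- exp_plus, <- exp_0; f_equal; ring).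
  transitivity (p * exp ((p - 2) * ln a) +
    (q - p) * (exp ((p - 2) * ln a) * exp (2 * ln a)) -
    q * (exp ((p - 2) * ln a) * exp ((2 - p) * ln a))); [rewrite E|]; ring.
Qed.

Lemma slope_nonneg_iff (p q a : R) :
  0 < a ->
  (0 <= slope p q a <-> (p - q) * exp (2 * ln a) + q * exp ((2 - p) * ln a) <= p).
Proof.
  intros Ha. rewrite slope_factor by auto.
  assert (0 < Rpower a (p - 2)) by apply exp_pos.
  split; intros H1; nra.
Qed.

(* The left-hand side of [slope_nonneg_iff] is convex in [ln a] and equals [p] at [a = 1]. *)
Lemma slope_nonneg_upward (p q a c : R) :
  0 < q <= p -> 0 < a <= c -> c < 1 -> 0 <= slope p q a -> 0 <= slope p q c.
Proof.
  intros Hq Ha Hc. rewrite !slope_nonneg_iff by lra. intros H.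
  assert (Hla : ln a < 0) by (rewrite <- ln_1; apply ln_increasing; lra).
  assert (Hlc : ln c < 0) by (rewrite <- ln_1; apply ln_increasing; lra).
  assert (Hac : ln a <= ln c) by (apply ln_le; lra).
  set (lam := ln c / ln a).
  assert (E : ln c = lam * ln a) by (unfold lam; field; lra).
  assert (Hl : 0 <= lam <= 1) by nra.
  pose proof (exp_convex_chord lam (2 * ln a) Hl) as H1.
  pose proof (exp_convex_chord lam ((2 - p) * ln a) Hl) as H2.
  replace (lam * (2 * ln a)) with (2 * ln c) in H1 by (rewrite E; ring).
  replace (lam * ((2 - p) * ln a)) with ((2 - p) * ln c) in H2 by (rewrite E; ring).
  apply (Rmult_le_compat_l (p - q)) in H1; [|lra].
  apply (Rmult_le_compat_l q) in H2; [|lra].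
  nra.
Qed.

(* The left-hand side of [slope_nonneg_iff] is concave in [a^(2-p)] and equals [p] at [a = 1]. *)
Lemma slope_nonneg_downward (p q a c : R) :
  1 <= p < 2 -> 2 < q -> 0 < a <= c -> c < 1 -> 0 <= slope p q c -> 0 <= slope p q a.
Proof.
  intros Hp Hq Ha Hc. rewrite !slope_nonneg_iff by lra. intros H.
  assert (Hlc : ln c < 0) by (rewrite <- ln_1; apply ln_increasing; lra).
  assert (Hac : ln a <= ln c) by (apply ln_le; lra).
  set (mu := (2 - p) / 2).
  assert (Hmu : 0 < mu <= 1) by (unfold mu; lra).
  assert (Bern : forall y, exp ((2 - p) * y) <= mu * exp (2 * y) + (1 - mu)).
  { intros y. replace ((2 - p) * y) with (mu * (2 * y)) by (unfold mu; field).
    apply exp_convex_chord; lra. }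
  (* With [U = V^mu], these bound [y^mu] by its tangent at [V], for [y = v] and [y = 1]. Averaged
     with the [lam] for which [U = lam u + (1 - lam)], they give [V <= lam v + (1 - lam)]; the
     coefficient [p - q] of [v] is negative. *)
  pose proof (Bern (ln a - ln c)) as B1. pose proof (Bern (- ln c)) as B2.
  set (U := exp ((2 - p) * ln c)) in *. set (V := exp (2 * ln c)) in *.
  set (u := exp ((2 - p) * ln a)) in *. set (v := exp (2 * ln a)) in *.
  assert (HU : 0 < U) by apply exp_pos. assert (HV : 0 < V) by apply exp_pos.
  assert (Hu : 0 < u) by apply exp_pos.
  assert (HU1 : U < 1) by (unfold U; rewrite <- exp_0; apply exp_increasing; nra).
  assert (HuU : u <= U).
  { unfold u, U. destruct (Req_dec (ln a) (ln c)) as [->|Hne]; [lra|].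
    left. apply exp_increasing. nra. }
  replace (exp ((2 - p) * (ln a - ln c))) with (u / U) in B1.
  2:{ unfold u, U, Rdiv. rewrite <- exp_Ropp, <- exp_plus. f_equal. ring. }
  replace (exp (2 * (ln a - ln c))) with (v / V) in B1.
  2:{ unfold v, V, Rdiv. rewrite <- exp_Ropp, <- exp_plus. f_equal. ring. }
  replace (exp ((2 - p) * - ln c)) with (1 / U) in B2.
  2:{ unfold U, Rdiv. rewrite Rmult_1_l, <- exp_Ropp. f_equal. ring. }
  replace (exp (2 * - ln c)) with (1 / V) in B2.
  2:{ unfold V, Rdiv. rewrite Rmult_1_l, <- exp_Ropp. f_equal. ring. }
  set (lam := (1 - U) / (1 - u)).
  assert (El : lam * (1 - u) = 1 - U) by (unfold lam; field; lra).
  assert (Hl : 0 < lam) by (unfold lam; apply Rdiv_lt_0_compat; lra).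
  assert (Hl1 : lam <= 1) by nra.
  apply (Rmult_le_compat_l lam) in B1; [|lra].
  apply (Rmult_le_compat_l (1 - lam)) in B2; [|lra].
  assert (E1 : lam * (u / U) + (1 - lam) * (1 / U) = 1).
  { transitivity ((1 - lam * (1 - u)) / U); [field; lra|]. rewrite El. field. lra. }
  assert (HVl : V <= lam * v + (1 - lam)).
  { assert (H2 : mu <= mu * ((lam * v + (1 - lam)) / V)).
    { replace (mu * ((lam * v + (1 - lam)) / V))
        with (lam * (mu * (v / V)) + (1 - lam) * (mu * (1 / V))) by (field; lra). lra. }
    assert (H3 : 1 <= (lam * v + (1 - lam)) / V) by (apply (Rmult_le_reg_l mu); lra).
    apply <- Rle_div_r in H3; lra. }
  assert (EU : U = lam * u + (1 - lam)) by lra.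
  assert (lam * ((p - q) * v + q * u) <= lam * p); [|apply (Rmult_le_reg_l lam); lra].
  nra.
Qed.

(** [logratio] tends to 0 at 0 and does not increase while [slope] is nonpositive. *)
Lemma logratio_neg_of_slope (p q a : R) :
  1 <= p -> 1 <= q -> 0 < a < 1 ->
  (forall c, 0 < c < a -> slope p q c <= 0) -> logratio p q a <= 0.
Proof.
  intros Hp Hq Ha Hs. apply Rnot_lt_le. intros HL.
  set (l := logratio p q a) in *.
  assert (Hx : exp (- l / 2) < 1) by (rewrite <- exp_0; apply exp_increasing; lra).
  (* Small enough that [1 - e^p >= 1 - e > exp (- l / 2)], hence [logratio e < l]. *)
  set (e := Rmin (a / 2) ((1 - exp (- l / 2)) / 2)).
  assert (He : 0 < e) by (unfold e; apply Rmin_glb_lt; lra).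
  assert (He1 : e <= a / 2) by apply Rmin_l.
  assert (He2 : e <= (1 - exp (- l / 2)) / 2) by apply Rmin_r.
  destruct (logratio_mvt p q e a) as [c [k [Hc [Hk E]]]]; [lra..|].
  specialize (Hs c ltac:(lra)). fold l in E.
  assert (H1 : l <= logratio p q e) by nra.
  unfold logratio in H1.
  assert (H2 : ln (1 - e ^ 2) <= 0) by (rewrite <- ln_1; apply ln_le; nra).
  assert (H3 : Rpower e p <= e).
  { rewrite <- (Rpower_1 e) at 2 by lra. unfold Rpower.
    assert (ln e < 0) by (rewrite <- ln_1; apply ln_increasing; lra).
    destruct (Req_dec p 1) as [->|Hne]; [lra|]. left. apply exp_increasing. nra. }
  assert (H4 : - l / 2 < ln (1 - Rpower e p)).
  { rewrite <- (ln_exp (- l / 2)). apply ln_increasing; [apply exp_pos|].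
    pose proof (exp_pos (- l / 2)). lra. }
  nra.
Qed.

(** * Infima and the value of the Bohr radius in each range *)

Lemma inf_on_le (lo a : R) (F : R -> R) :
  lo <= a < 1 -> Rbar_le (inf_on lo F) (Finite (F a)).
Proof. intros Ha. apply (proj1 (Glb_Rbar_correct _)). now exists a. Qed.

Lemma inf_on_ge (lo y : R) (F : R -> R) :
  (forall a, lo <= a < 1 -> y <= F a) -> Rbar_le (Finite y) (inf_on lo F).
Proof.
  intros H. apply (proj2 (Glb_Rbar_correct _)). intros z [a [Ha ->]]. now apply H.
Qed.

Lemma inf_on_finite (lo y : R) (F : R -> R) :
  lo < 1 -> (forall a, lo <= a < 1 -> y <= F a) ->
  exists m, inf_on lo F = Finite m /\ y <= m /\ (forall a, lo <= a < 1 -> m <= F a).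
Proof.
  intros Hlo H.
  pose proof (inf_on_ge lo y F H) as H1.
  pose proof (fun a Ha => inf_on_le lo a F Ha) as H2.
  destruct (inf_on lo F) as [m| |].
  - exists m. split; [reflexivity|split; [exact H1|exact H2]].
  - now specialize (H2 lo ltac:(lra)).
  - now simpl in H1.
Qed.

Lemma inf_on_ge_of_forall (lo : R) (F : R -> R) (v : Rbar) :
  (forall a, lo <= a < 1 -> Rbar_le v (Finite (F a))) -> Rbar_le v (inf_on lo F).
Proof.
  intros H. apply (proj2 (Glb_Rbar_correct _)). intros z [a [Ha ->]]. now apply H.
Qed.

Lemma R_C_le_inf_A (p q lo : R) :
  0 < p -> 0 < q -> 0 <= lo -> Rbar_le (R_C p q) (inf_on lo (A_pq p q)).
Proof.
  intros Hp Hq Hlo. apply inf_on_ge_of_forall. intros a Ha. apply R_C_le_A_pq; lra.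
Qed.

Lemma A_pq_fixed (p q ahat : R) :
  0 < ahat < 1 -> beta p q ahat = ahat -> A_pq p q ahat = ahat.
Proof.
  intros Ha Hb. rewrite A_pq_beta, Hb. field. lra.
Qed.

Lemma R_C_ge_of_below (p q ahat T : R) :
  0 < p -> 0 < q -> 0 < ahat < 1 -> beta p q ahat = ahat ->
  0 <= T <= 1 -> (forall a, ahat <= a < 1 -> T <= A_pq p q a) ->
  (forall a, 0 <= a < ahat -> below_S p q a T) ->
  Rbar_le (Finite T) (R_C p q).
Proof.
  intros Hp Hq Ha Hb HT HA HS. apply R_C_ge; auto.
  intros a Ha1. destruct (Rlt_or_le a ahat) as [H|H]; [left; apply HS; lra|right].
  split; [|apply HA; lra].
  pose proof (beta_antitone p q ahat a Hp Hq ltac:(lra) ltac:(lra)). lra.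
Qed.

Lemma R_C_eq_inf_A (p q ahat : R) :
  0 < p -> 0 < q -> 0 < ahat < 1 -> beta p q ahat = ahat ->
  (forall c, 0 < c < ahat -> 0 <= slope p q c) ->
  R_C p q = inf_on ahat (A_pq p q).
Proof.
  intros Hp Hq Ha Hb Hs.
  apply Rbar_le_antisym; [apply R_C_le_inf_A; lra|].
  destruct (inf_on_finite ahat 0 (A_pq p q)) as [m [-> [Hm0 Hm]]]; [lra| |].
  { intros a Ha1. left. apply A_pq_pos; lra. }
  (* The infimum is at most its value at the left end point, so below [ahat] it suffices to compare
     [S_pq] with [ahat]. *)
  assert (Hma : m <= ahat) by (rewrite <- (A_pq_fixed p q ahat) by auto; apply Hm; lra).
  assert (HS : forall a, 0 < a < ahat -> below_S p q a m).
  { intros a Ha1. apply below_S_mono with (T' := ahat); [lra..|].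
    apply below_S_of_slope; [auto..|lra|auto|]. intros c Hc. apply Hs. lra. }
  apply (R_C_ge_of_below p q ahat); auto; [lra|].
  intros a [[H0|<-] H1]; [now apply HS; split|].
  apply (below_S_0 p q ahat); auto; lra.
Qed.

Lemma R_C_eq_min_inf_A (p q ahat : R) :
  2 < p -> 1 <= q <= 2 -> 0 < ahat < 1 -> beta p q ahat = ahat ->
  R_C p q = Rbar_min (Finite (1 / sqrt 2)) (inf_on ahat (A_pq p q)).
Proof.
  intros Hp Hq Ha Hb.
  pose proof (R_C_le_inv_sqrt_2 p q ltac:(lra) ltac:(lra)) as HU1.
  pose proof (R_C_le_inf_A p q ahat ltac:(lra) ltac:(lra) ltac:(lra)) as HU2.
  destruct (inf_on_finite ahat 0 (A_pq p q)) as [m [E [Hm0 Hm]]]; [lra| |].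
  { intros a Ha1. left. apply A_pq_pos; lra. }
  rewrite E in *.
  change (Rbar_min ?t (Finite m)) with (Finite (Rmin (1 / sqrt 2) m)).
  apply Rbar_le_antisym; [unfold Rmin; destruct (Rle_dec _ _); assumption|].
  assert (Hma : m <= ahat) by (rewrite <- (A_pq_fixed p q ahat) by auto; apply Hm; lra).
  pose proof inv_sqrt_2_bounds as Ht. pose proof inv_sqrt_2_sqr as Ht2.
  generalize dependent (1 / sqrt 2). intros t HU1 Ht Ht2.
  assert (Ht' : 0 <= Rmin t m) by (apply Rmin_glb; lra).
  pose proof (Rmin_l t m). pose proof (Rmin_r t m).
  apply (R_C_ge_of_below p q ahat); auto; [lra..| |].
  { intros a Ha1. specialize (Hm a Ha1). lra. }
  intros a [[Ha0|<-] Ha1].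
  (* If [slope] is nonnegative at [a] it stays so up to [ahat], and [ahat] is the bound; if
     negative, it is negative all the way down to 0, and [1 / sqrt 2] is the bound. *)
  - destruct (Rle_or_lt 0 (slope p q a)) as [HG|HG].
    + apply below_S_mono with (T' := ahat); [lra..|].
      apply below_S_of_slope; [lra..|auto|].
      intros c Hc. apply slope_nonneg_upward with a; lra.
    + apply below_S_mono with (T' := t); [lra..|].
      apply below_S_of_logratio; [lra..|]. rewrite Ht2.
      replace (1 - 1 / 2) with (1 / 2) by field. rewrite Rminus_diag, Rmult_0_r.
      apply logratio_neg_of_slope; [lra..|].
      intros c Hc. apply Rnot_lt_le. intros Hlt.
      pose proof (slope_nonneg_upward p q c a ltac:(lra) ltac:(lra) ltac:(lra) ltac:(lra)).
      lra.
  - apply below_S_mono with (T' := t); [lra..|].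
    unfold below_S. rewrite beta_0_l, Ht2. lra.
Qed.

(** [beta^2] is the power [2 / q <= 1] of a number in [(0, 1]]. *)
Lemma one_sub_le_beta_sqr (p q a : R) :
  0 < p -> 2 <= q -> 0 <= a < 1 -> 1 - rpow a p <= beta p q a ^ 2.
Proof.
  intros Hp Hq Ha. rewrite <- beta_sqr by lra.
  pose proof (rpow_lt_1 p a Hp Ha). pose proof (rpow_ge_0 a p).
  assert (Hx : 0 < 1 - rpow a p <= 1) by lra.
  set (x := 1 - rpow a p) in *.
  rewrite <- (rpow_1_r x) at 1 by lra.
  rewrite !rpow_pos by lra. unfold Rpower.
  assert (Hl : ln x <= 0) by (rewrite <- ln_1; apply ln_le; lra).
  assert (H2 : 2 / q <= 1) by (apply <- Rle_div_l; lra).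
  assert (H3 : 1 * ln x <= 2 / q * ln x) by nra.
  destruct H3 as [H3|H3]; [left; now apply exp_increasing | rewrite H3; lra].
Qed.

Lemma rpow_le_exponent (a r s : R) : 0 <= a <= 1 -> r <= s -> rpow a s <= rpow a r.
Proof.
  intros [[Ha|<-] Ha1] Hrs; [|rewrite !rpow_0_l; lra].
  rewrite !rpow_pos by lra. unfold Rpower.
  assert (Hl : ln a <= 0) by (rewrite <- ln_1; apply ln_le; lra).
  assert (H3 : s * ln a <= r * ln a) by nra.
  destruct H3 as [H3|H3]; [left; now apply exp_increasing | rewrite H3; lra].
Qed.

Lemma R_C_eq_inv_sqrt_2 (p q : R) :
  2 <= p -> 2 <= q -> R_C p q = Finite (1 / sqrt 2).
Proof.
  intros Hp Hq.
  apply Rbar_le_antisym; [apply R_C_le_inv_sqrt_2; lra|].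
  pose proof inv_sqrt_2_bounds as Ht. pose proof inv_sqrt_2_sqr as Ht2.
  (* At [T^2 = 1/2] the criterion reads [1 - a^2 <= beta^2], and [1 - a^2 <= 1 - a^p <= beta^2]. *)
  apply R_C_ge; [lra..|]. intros a Ha. left. unfold below_S. rewrite Ht2.
  pose proof (one_sub_le_beta_sqr p q a ltac:(lra) Hq Ha).
  pose proof (rpow_le_exponent a 2 p ltac:(lra) Hp) as H2.
  rewrite rpow_2_r in H2 by lra. lra.
Qed.

(** The claim amounts to [1 - a^2 <= 3 beta^2], and [1 - a^2 <= 2 (1 - a) <= 2 beta^2]. It makes the
    infimum of [S_pq] positive. *)
Lemma S_pq_ge_half (p q a : R) :
  1 <= p -> 2 <= q -> 0 <= a < 1 -> 1 / 2 <= S_pq p q a.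
Proof.
  intros Hp Hq Ha. apply below_S_iff; [lra..|]. unfold below_S.
  pose proof (one_sub_le_beta_sqr p q a ltac:(lra) Hq Ha).
  pose proof (rpow_le_exponent a 1 p ltac:(lra) Hp) as H2.
  rewrite rpow_1_r in H2 by lra. nra.
Qed.

Lemma inf_S_pq_pos_le_R_C (p q : R) :
  1 <= p -> 2 <= q ->
  Rbar_lt (Finite 0) (inf_on 0 (S_pq p q)) /\
  Rbar_le (inf_on 0 (S_pq p q)) (R_C p q).
Proof.
  intros Hp Hq.
  destruct (inf_on_finite 0 (1 / 2) (S_pq p q)) as [m [-> [Hm0 Hm]]]; [lra| |].
  { intros a Ha. now apply S_pq_ge_half. }
  split; [simpl; lra|].
  assert (Hm1 : m <= 1).
  { pose proof (Hm 0 ltac:(lra)) as H0.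
    apply below_S_iff in H0; [|lra..].
    unfold below_S in H0. rewrite beta_0_l in H0. nra. }
  apply R_C_ge; [lra..|]. intros a Ha. left. apply below_S_iff; [lra..|]. now apply Hm.
Qed.

(** The hypothesis is [slope >= 0] multiplied by [a^2]. *)
Lemma slope_nonneg_of_hyp (p q a : R) :
  0 < a ->
  q * rpow a 2 + p * rpow a (p + 2) <= p * rpow a p + q * rpow a (p + 2) ->
  0 <= slope p q a.
Proof.
  intros Ha. rewrite !rpow_pos, Rpower_plus by auto. intros H.
  assert (E : Rpower a p = Rpower a (p - 2) * Rpower a 2)
    by (rewrite <- Rpower_plus; f_equal; ring).
  assert (H2 : 0 < Rpower a 2) by apply exp_pos.
  unfold slope. apply (Rmult_le_reg_l (Rpower a 2)); [exact H2|].
  replace (Rpower a 2 * (p * Rpower a (p - 2) + (q - p) * Rpower a p - q))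
    with (p * Rpower a p + (q - p) * Rpower a p * Rpower a 2 - q * Rpower a 2)
    by (rewrite E; ring).
  lra.
Qed.

Theorem theorem1p1 (p q ahat : R) (hp : 1 <= p) (hq : 1 <= q)
  (ha : 0 < ahat < 1) (hroot : rpow ahat p + rpow ahat q = 1) :
  (* (i) *)
  (p <= 2 -> q <= 2 -> R_C p q = inf_on ahat (A_pq p q)) /\
  (* (ii) *)
  (2 < p -> q <= 2 ->
     R_C p q = Rbar_min (Finite (1 / sqrt 2)) (inf_on ahat (A_pq p q))) /\
  (* (iii) *)
  (2 <= p -> 2 <= q -> R_C p q = Finite (1 / sqrt 2)) /\
  (* (iv), first part *)
  (p = 2 -> 2 < q -> R_C p q = Finite (1 / sqrt 2)) /\
  (* (iv), second part *)
  (p < 2 -> 2 < q ->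
     q * rpow ahat 2 + p * rpow ahat (p + 2) <= p * rpow ahat p + q * rpow ahat (p + 2) ->
     R_C p q = inf_on ahat (A_pq p q)) /\
  (* (v) *)
  (p < 2 -> 2 < q ->
     Rbar_lt (Finite 0) (inf_on 0 (S_pq p q)) /\
     Rbar_le (inf_on 0 (S_pq p q)) (R_C p q) /\
     Rbar_le (R_C p q) (Finite (1 / sqrt 2))).
Proof.
  pose proof (beta_fixed p q ahat ltac:(lra) ha hroot) as Hb.
  repeat apply conj.
  - intros Hp2 Hq2. apply R_C_eq_inf_A; [lra..|exact Hb|].
    intros c Hc. apply slope_nonneg_small; lra.
  - intros Hp2 Hq2. apply R_C_eq_min_inf_A; [lra..|exact Hb].
  - apply R_C_eq_inv_sqrt_2.
  - intros -> Hq2. apply R_C_eq_inv_sqrt_2; lra.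
  - intros Hp2 Hq2 Hh. apply R_C_eq_inf_A; [lra..|exact Hb|].
    intros c Hc. apply slope_nonneg_downward with ahat; [lra..|].
    apply slope_nonneg_of_hyp; [lra|exact Hh].
  - intros Hp2 Hq2. destruct (inf_S_pq_pos_le_R_C p q) as [H1 H2]; [lra..|].
    split; [exact H1|split; [exact H2|]]. apply R_C_le_inv_sqrt_2; lra.
Qed.
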